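(* Let $\mathbb{F}_2$ be the free group on two generators $a,b$. For any $\epsilon>0$ and any integer $n\geq1$ there is a projection $P\in B(\ell^2\mathbb{F}_2)$ of rank $n$ such that $\|[\lambda_a,P]\|<1/2+\epsilon$ and $\|[\lambda_b,P]\|<1/2+\epsilon$. In particular, $$C_{\{a,b\}}=1/2.$$
   Context: $\lambda\colon\mathbb{F}_2\to B(\ell^2\mathbb{F}_2)$ is the left regular representation, $\lambda_s\delta_t=\delta_{st}$; projections are self-adjoint; $[S,T]=ST-TS$. For a finite subset $F$ of a group $\Gamma$, $$C_F:=\inf_{P}\ \sup_{x\in F}\|[\lambda_x,P]\|,$$ where the infimum is over all non-zero finite-rank projections $P$ on $\ell^2\Gamma$. *)

(* Defs.v *)
From HB Require Import structures.
From mathcomp Require Import all_boot all_order all_algebra finmap.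
From mathcomp Require Import all_classical all_reals ereal sequences numfun esum.
From mathcomp Require Import complex ring lra.

Set Implicit Arguments.
Unset Strict Implicit.
Unset Printing Implicit Defensive.
Import Order.TTheory GRing.Theory Num.Theory.

Local Open Scope classical_set_scope.
Local Open Scope ring_scope.

(* The free group on two generators, as the group of reduced words. The letter
   (g, e) stands for the generator a (g = false) or b (g = true), inverted when
   e = true. *)
Section FreeGroup.

Definition letter : Type := (bool * bool)%type.

Definition linv (l : letter) : letter := (l.1, ~~ l.2).

Lemma linvK : involutive linv.
Proof. by case=> g e; rewrite /linv /= negbK. Qed.

Definition reduced (w : seq letter) : bool :=
  sorted (fun x y => y != linv x) w.

Definition consr (l : letter) (w : seq letter) : seq letter :=
  if w is h :: t then if h == linv l then t else l :: w else [:: l].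

Definition mulw (u v : seq letter) : seq letter := foldr consr v u.

Definition invw (w : seq letter) : seq letter := rev (map linv w).

Lemma consr_reduced l w : reduced w -> reduced (consr l w).
Proof.
case: w => [|h t] //= ht; case: ifPn => [_|hl]; first exact: path_sorted ht.
by rewrite /reduced /= hl.
Qed.

Lemma mulw_reduced u v : reduced v -> reduced (mulw u v).
Proof. by move=> rv; elim: u => //= l u; exact: consr_reduced. Qed.

Lemma linv_neq l : linv l != l.
Proof. by case: l => [[] []]. Qed.

Lemma consrK l w : reduced w -> consr (linv l) (consr l w) = w.
Proof.
case: w => [|h t] rw /=; first by rewrite linvK eqxx.
case: ifPn => [/eqP eh|hl]; last by rewrite /= linvK eqxx.
move: rw; rewrite eh; case: t => [|k t] //= /andP[].
by rewrite /= linvK => /negPf ->.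
Qed.

Lemma consrVK l w : reduced w -> consr l (consr (linv l) w) = w.
Proof. by move=> rw; rewrite -{1}[l]linvK consrK. Qed.

Lemma consr_mulw l u v : reduced v -> mulw (consr l u) v = consr l (mulw u v).
Proof.
case: u => [|h t] //= rv; case: ifPn => [/eqP ->|//].
by rewrite consrVK// mulw_reduced.
Qed.

Lemma mulwA u v w : reduced w -> mulw u (mulw v w) = mulw (mulw u v) w.
Proof. by move=> rw; elim: u => //= l u IH; rewrite consr_mulw// IH. Qed.

Lemma mulw1 u : reduced u -> mulw u [::] = u.
Proof.
elim: u => //= l u IH ru; rewrite IH; last exact: path_sorted ru.
by case: u ru {IH} => [|h t] //= /andP[/negPf ->].
Qed.

Lemma invwK : involutive invw.
Proof.
by move=> u; rewrite /invw map_rev revK -map_comp map_id_in// => l _; exact: linvK.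
Qed.

Lemma invw_reduced u : reduced u -> reduced (invw u).
Proof.
rewrite /reduced /invw rev_sorted sorted_map; apply: sub_sorted => x y.
by rewrite /= linvK eq_sym.
Qed.

Lemma mulKw u w : reduced w -> mulw (invw u) (mulw u w) = w.
Proof.
move=> rw; elim: u => //= l u IH.
by rewrite /invw /= rev_cons /mulw foldr_rcons consrK ?mulw_reduced.
Qed.

Lemma mulVKw u w : reduced w -> mulw u (mulw (invw u) w) = w.
Proof. by move=> rw; rewrite -{1}[u]invwK mulKw. Qed.

Record F2 := MkF2 { F2word :> seq letter; F2wordP : reduced F2word }.

HB.instance Definition _ := [isSub for F2word].
HB.instance Definition _ := [Choice of F2 by <:].

Definition F2one : F2 := @MkF2 [::] isT.
Definition F2inv (u : F2) : F2 := MkF2 (invw_reduced (F2wordP u)).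
Definition F2mul (u v : F2) : F2 := MkF2 (mulw_reduced u (F2wordP v)).

Lemma F2mulA : associative F2mul.
Proof. by move=> u v w; apply: val_inj; rewrite /= mulwA//; exact: F2wordP. Qed.

Lemma F2mul1g : left_id F2one F2mul.
Proof. by move=> u; apply: val_inj. Qed.

Lemma F2mulg1 : right_id F2one F2mul.
Proof. by move=> u; apply: val_inj; rewrite /= mulw1//; exact: F2wordP. Qed.

Lemma F2mulVg : left_inverse F2one F2inv F2mul.
Proof.
move=> u; apply: val_inj; rewrite /= -[X in mulw _ X]mulw1; last exact: F2wordP.
by rewrite mulKw.
Qed.

Lemma F2mulgV : right_inverse F2one F2inv F2mul.
Proof.
move=> u; apply: val_inj; rewrite /= -[X in mulw _ X]mulw1 ?mulVKw//.
exact: invw_reduced (F2wordP u).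
Qed.

HB.instance Definition _ :=
  isGroup.Build F2 F2mulA F2mul1g F2mulg1 F2mulVg F2mulgV.

Definition gen_a : F2 := @MkF2 [:: (false, false)] isT.
Definition gen_b : F2 := @MkF2 [:: (true, false)] isT.

End FreeGroup.

(* The Hilbert space l2 G of square-summable functions G -> C, where C = R[i]. *)
Section SquareSummable.
Variables (R : realType) (G : choiceType).
Implicit Types f g : G -> R[i].

Definition sqsum f : \bar R :=
  (\esum_(x in [set: G]) (Normc.normc (f x) ^+ 2)%:E)%E.

Definition l2_pred : {pred G -> R[i]} := fun f => `[< (sqsum f < +oo)%E >].

Lemma sqsum_ge0 f : (0 <= sqsum f)%E.
Proof. by apply: esum_ge0 => x _; rewrite lee_fin sqr_ge0. Qed.

Lemma sqsum0 : sqsum 0 = 0%E.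
Proof. by apply: esum1 => x _; rewrite Normc.normc0 expr0n. Qed.

Lemma sqsumD f g : (sqsum (f + g)%R <= 2%:E * (sqsum f + sqsum g))%E.
Proof.
have sq0 (h : G -> R[i]) x : (0 <= (Normc.normc (h x) ^+ 2)%:E)%E.
  by rewrite lee_fin sqr_ge0.
rewrite -[2%R]/(1 + 1)%R EFinD ge0_muleDl// !mul1e /sqsum -!esumD//; first last.
- by move=> x _; rewrite adde_ge0.
- by move=> x _; rewrite adde_ge0.
apply: le_esum => x _; rewrite -!EFinD lee_fin.
have h := le_normcD (f x) (g x).
have h0 : 0 <= Normc.normc ((f + g) x) by case: ((f + g) x) => p q; exact: sqrtr_ge0.
move: h h0; rewrite -[(f + g) x]/(f x + g x).
move: (Normc.normc (f x + g x)) (Normc.normc (f x)) (Normc.normc (g x)) => c a b h h0.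
have : c ^+ 2 <= (a + b) ^+ 2 by rewrite lerXn2r// nnegrE// (le_trans h0).
move/le_trans; apply.
rewrite -subr_ge0 (_ : _ - _ = (a - b) ^+ 2) ?sqr_ge0//.
by ring.
Qed.

Lemma sqsumZ (c : R[i]) f : sqsum f \is a fin_num ->
  (sqsum (c *: f)%R <= (Normc.normc c ^+ 2)%:E * sqsum f)%E.
Proof.
move=> ff; apply: ge_ereal_sup => _ [A [finA _] <-].
rewrite (eq_fsbigr (fun x => (Normc.normc c ^+ 2)%:E * (Normc.normc (f x) ^+ 2)%:E)%E);
  last by move=> x _; rewrite -EFinM -exprMn -Normc.normcM.
rewrite -ge0_mule_fsumr; last by move=> x; rewrite lee_fin sqr_ge0.
apply: lee_wpmul2l; first by rewrite lee_fin sqr_ge0.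
by apply: ereal_sup_ubound; exists A.
Qed.

Lemma l2_predP f : reflect (sqsum f \is a fin_num) (f \in l2_pred).
Proof.
apply: (iffP idP); first by move=> /asboolP; rewrite ge0_fin_numE ?sqsum_ge0.
by rewrite ge0_fin_numE ?sqsum_ge0// => ?; apply/asboolP.
Qed.

Lemma l2_pred_closed : GRing.subsemimod_closed l2_pred.
Proof.
split; first split; first by apply/l2_predP; rewrite sqsum0.
- move=> f g /asboolP ff /asboolP gg; apply/asboolP.
  apply: le_lt_trans (sqsumD f g) _.
  by rewrite lte_mul_pinfty ?lte_add_pinfty.
- move=> c f /l2_predP ff; apply/asboolP; apply: le_lt_trans (sqsumZ c ff) _.
  by rewrite lte_mul_pinfty ?lee_fin ?sqr_ge0// ltey_eq ff.
Qed.

HB.instance Definition _ :=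
  GRing.isSubmodClosed.Build R[i] (G -> R[i]) l2_pred l2_pred_closed.

Record l2 := MkL2 { l2_fun :> G -> R[i]; l2_funP : l2_fun \in l2_pred }.

HB.instance Definition _ := [isSub for l2_fun].
HB.instance Definition _ := [Choice of l2 by <:].
HB.instance Definition _ := [SubChoice_isSubLmodule of l2 by <:].

End SquareSummable.

Arguments MkL2 {R G} _ _.

Section Hilbert.
Variables (R : realType) (G : choiceType).
Implicit Types f g : l2 R G.

Definition l2norm f : R := Num.sqrt (fine (sqsum f)).

(* Sum of an absolutely summable family of reals: sum of the positive parts
   minus sum of the negative parts, as in summable_eseries_esum. *)
Definition rsum (h : G -> R) : R :=
  fine (esum [set: G] (EFin \o h)^\+%E) - fine (esum [set: G] (EFin \o h)^\-%E).

Definition csum (h : G -> R[i]) : R[i] :=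
  Complex (rsum (fun x => complex.Re (h x))) (rsum (fun x => complex.Im (h x))).

Definition l2dot f g : R[i] := csum (fun x => f x * conjc (g x)).

Lemma l2norm_ge0 f : 0 <= l2norm f.
Proof. exact: sqrtr_ge0. Qed.

Lemma l2norm_sqr f : (l2norm f ^+ 2)%:E = sqsum f.
Proof.
have /l2_predP ff := l2_funP f.
by rewrite /l2norm sqr_sqrtr ?fineK// fine_ge0// sqsum_ge0.
Qed.

Lemma l2normN f : l2norm (- f) = l2norm f.
Proof.
rewrite /l2norm /sqsum; congr (Num.sqrt (fine _)); apply: eq_esum => x _.
by rewrite -[(- f) x]/(- (f x)) normcN.
Qed.

Lemma l2normD f g : l2norm (f + g) <= 2 * (l2norm f + l2norm g).
Proof.
have f0 := l2norm_ge0 f; have g0 := l2norm_ge0 g.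
have : l2norm (f + g) ^+ 2 <= 2 * (l2norm f ^+ 2 + l2norm g ^+ 2).
  rewrite -lee_fin (EFinM 2) (EFinD (l2norm f ^+ 2)) !l2norm_sqr.
  exact: sqsumD.
move=> h; rewrite -ler_sqr ?nnegrE ?l2norm_ge0//; last by lra.
apply: le_trans h _; nra.
Qed.

Definition l2_bounded (T : l2 R G -> l2 R G) : Prop :=
  exists M : R, forall f, l2norm (T f) <= M * l2norm f.

(* The bounded operators: B(l2 G). *)
Record l2op := MkL2op {
  l2op_fun :> {linear l2 R G -> l2 R G};
  l2opP : l2_bounded l2op_fun }.

(* The real supremum is the true one: the set contains 0 and is bounded. *)
Definition opnorm (T : l2op) : R :=
  sup [set l2norm (T f) | f in [set f | l2norm f <= 1]].

Lemma comm_bounded (S T : l2op) :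
  l2_bounded ((S \o T) \- (T \o S)).
Proof.
have [[M HM] [N HN]] := (l2opP S, l2opP T).
have pos (K : R) U : (forall f, l2norm (U f) <= K * l2norm f) ->
    forall f, l2norm (U f) <= `|K| * l2norm f.
  move=> HK f; apply: le_trans (HK f) _.
  by rewrite ler_wpM2r ?l2norm_ge0// ler_norm.
exists (2 * (`|M| * `|N| + `|N| * `|M|)) => f.
apply: le_trans (l2normD _ _) _; rewrite l2normN /=.
rewrite -mulrA ler_wpM2l// mulrDl lerD// -mulrA.
  by apply: le_trans (pos _ _ HM _) _; rewrite ler_wpM2l// pos.
by apply: le_trans (pos _ _ HN _) _; rewrite ler_wpM2l// pos.
Qed.

Definition comm (S T : l2op) : l2op :=
  @MkL2op ((S \o T) \- (T \o S)) (comm_bounded S T).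

Definition is_projection (P : l2op) : Prop :=
  (forall f, P (P f) = P f) /\ (forall f g, l2dot (P f) g = l2dot f (P g)).

(* The range of T has a basis of n vectors. *)
Definition has_rank (T : l2op) (n : nat) : Prop :=
  exists e : 'I_n -> l2 R G,
    (forall c : 'I_n -> R[i], \sum_i c i *: e i = 0 -> forall i, c i = 0) /\
    range T = range (fun c : 'I_n -> R[i] => \sum_i c i *: e i).

Definition finite_rank (T : l2op) : Prop := exists n, has_rank T n.

End Hilbert.

Section Regular.
Variables (R : realType) (G : groupType).

Definition delta_fun (t : G) : G -> R[i] := fun u => (u == t)%:R.

Lemma delta_subproof t : delta_fun t \in @l2_pred R G.
Proof.
apply/l2_predP; rewrite /sqsum (esumID [set t]); last first.
  by move=> x _; rewrite lee_fin sqr_ge0.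
rewrite setTI setTI esum_set1 ?lee_fin ?sqr_ge0// esum1 ?adde0//.
by move=> x /= /eqP/negPf xt; rewrite /delta_fun xt Normc.normc0 expr0n.
Qed.

Definition delta (t : G) : l2 R G := MkL2 (delta_fun t) (delta_subproof t).

Lemma sqsum_translate (s : G) (f : G -> R[i]) :
  sqsum (fun t => f (s^-1 * t)%g) = sqsum f.
Proof.
rewrite /sqsum [RHS](reindex_esum setT setT (fun t => s^-1 * t)%g)//.
split=> //; first by move=> x y _ _; exact: mulgI.
by move=> y _; exists (s * y)%g => //; rewrite mulKg.
Qed.

Lemma lreg_subproof (s : G) (f : l2 R G) :
  (fun t => f (s^-1 * t)%g) \in @l2_pred R G.
Proof. by apply/l2_predP; rewrite sqsum_translate; apply/l2_predP/l2_funP. Qed.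

Definition lreg_fun (s : G) (f : l2 R G) : l2 R G :=
  MkL2 (fun t => f (s^-1 * t)%g) (lreg_subproof s f).

Lemma lreg_linear s : linear (lreg_fun s).
Proof. by move=> c f g; apply: val_inj; apply/funext => t. Qed.

HB.instance Definition _ s :=
  GRing.isLinear.Build R[i] (l2 R G) (l2 R G) _ (lreg_fun s) (lreg_linear s).

Lemma lreg_bounded s : l2_bounded (lreg_fun s).
Proof. by exists 1 => f; rewrite mul1r /l2norm sqsum_translate. Qed.

Definition lreg (s : G) : l2op R G := MkL2op (lreg_bounded s).

Lemma lreg_delta s t : lreg s (delta t) = delta (s * t)%g.
Proof.
apply: val_inj; apply/funext => u; rewrite /= /delta_fun.
by rewrite -(inj_eq (mulgI s)) mulVKg.
Qed.

(* For F empty the inner supremum is 0, the convention for sets of norms. *)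
Definition C_ (F : {fset G}) : R :=
  inf [set sup [set opnorm (comm (lreg x) P) | x in [set` F]] |
        P in [set P | is_projection P /\ finite_rank P /\ exists f, P f != 0]].

End Regular.

(* Main.v *)
(** The lower bound is Kesten's estimate with coefficients. If both commutators
    have norm at most [m], then for [x = a, b] the matrix [A] of [P lambda_x] on
    the range of [P] satisfies [|v A| >= s |v|] with [s = sqrt (1 - m ^ 2)], so
    [s A^-1] is a contraction. Pairing it with [A] and taking traces gives
    [2 s n <= sqrt 3 * n]: the pairing is a sum over the edges of the Cayley tree,
    which is estimated by the AM-GM inequality giving each edge the weight
    [sqrt 3 / 2] at its child and [1 / (2 sqrt 3)] at its parent. Hence
    [s <= sqrt 3 / 2] and [m >= 1 / 2].

    For the upper bound, the radial function [3 ^ (- |t| / 2)] cut off at a large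
    radius almost attains equality in this estimate, for [a] and for [b]
    separately. Right translates of it that are far apart are orthogonal, also
    after applying [lambda_a] or [lambda_b]; [P] projects onto their span. *)

From HB Require Import structures.
Require Import Defs.
From mathcomp Require Import all_boot all_order all_algebra finmap.
From mathcomp Require Import all_classical all_reals ereal sequences numfun esum.
From mathcomp Require Import complex ring lra.

Set Implicit Arguments.
Unset Strict Implicit.
Unset Printing Implicit Defensive.
Import Order.TTheory GRing.Theory Num.Theory.

Local Open Scope classical_set_scope.
Local Open Scope ring_scope.

(** * Summation over a set *)

Section RealSum.
Variables (R : realType) (T : choiceType).
Implicit Types (h p q : T -> R).

Definition rsummable h := summable [set: T] (EFin \o h).

Lemma rsummable_le h p : (forall x, `|h x| <= p x) -> rsummable p -> rsummable h.
Proof.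
move=> hp; rewrite /rsummable /summable; apply: le_lt_trans.
by apply: le_esum => x _; rewrite /= lee_fin (le_trans (hp x))// ler_norm.
Qed.

Lemma rsummableD h p : rsummable h -> rsummable p -> rsummable (fun x => h x + p x).
Proof. exact: summableD. Qed.

Lemma rsummableN h : rsummable h -> rsummable (fun x => - h x).
Proof. by rewrite /rsummable summableN. Qed.

(** The inequality [<=] holds for every nonnegative factor; applied to [c^-1] and the family [c * h]
    it gives the reverse one. *)
Lemma esumZ (c : R) h : (forall x, 0 <= h x) -> 0 <= c ->
  esum [set: T] (fun x => (c * h x)%:E) = (c%:E * esum [set: T] (EFin \o h))%E.
Proof.
have le (d : R) g : (forall x, 0 <= g x) -> 0 <= d ->
    (esum [set: T] (fun x => (d * g x)%:E) <= d%:E * esum [set: T] (EFin \o g))%E.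
  move=> g0 d0; apply: ge_ereal_sup => _ [A [finA _] <-].
  rewrite (eq_fsbigr (fun x => d%:E * (g x)%:E)%E);
    last by move=> x _; rewrite -EFinM.
  rewrite -ge0_mule_fsumr; last by move=> x; rewrite lee_fin.
  apply: lee_wpmul2l; first by rewrite lee_fin.
  by apply: ereal_sup_ubound; exists A.
move=> h0; rewrite le_eqVlt => /predU1P[<-|c0].
  by rewrite mul0e esum1// => x _; rewrite mul0r.
apply/eqP; rewrite eq_le le ?(ltW c0)//=.
have := @le c^-1 (fun x => c * h x); rewrite invr_ge0 ltW// => /(_ _ isT).
move=> /(_ (fun x => mulr_ge0 (ltW c0) (h0 x))).
move/(lee_wpmul2l (ltW (_ : 0 < c%:E)%E)) => /(_ _)/=.
rewrite lte_fin => /(_ c0); rewrite muleA -EFinM divff ?gt_eqF// mul1e.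
apply: le_trans; rewrite le_eqVlt; apply/orP; left; apply/eqP; congr (_ * _)%E.
by apply: eq_esum => x _; rewrite /= mulrA mulVf ?gt_eqF// mul1r.
Qed.

Lemma esum_rsum h : (forall x, 0 <= h x) -> rsum h = fine (esum [set: T] (EFin \o h)).
Proof.
move=> h0; rewrite /rsum [X in _ - fine X]esum1 ?subr0.
  congr fine; apply: eq_esum => x _.
  by rewrite (@ge0_funeposE _ _ setT) ?inE// => y _; rewrite lee_fin.
by move=> x _; rewrite (@ge0_funenegE _ _ setT) ?inE// => y _; rewrite lee_fin.
Qed.

Lemma rsummable_fin h : (forall x, 0 <= h x) ->
  rsummable h <-> esum [set: T] (EFin \o h) \is a fin_num.
Proof.
move=> h0; rewrite /rsummable summableE.
rewrite (_ : esum _ _ = esum [set: T] (EFin \o h))//.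
by apply: eq_esum => x _; rewrite /= ger0_norm.
Qed.

Lemma rsumK h : (forall x, 0 <= h x) -> rsummable h ->
  esum [set: T] (EFin \o h) = (rsum h)%:E.
Proof. by move=> h0 hs; rewrite esum_rsum// fineK//; apply/rsummable_fin. Qed.

(** The positive and negative parts of [p - q] need not be [p] and [q], but [esumB] shows that both
    decompositions give the same value. *)
Lemma rsumB_ge0 p q : (forall x, 0 <= p x) -> (forall x, 0 <= q x) ->
  rsummable p -> rsummable q -> rsum (fun x => p x - q x) = rsum p - rsum q.
Proof.
move=> p0 q0 sp sq.
have sb : rsummable (fun x => p x - q x) by apply: rsummableD => //; exact: rsummableN.
have := esumB sp sq (fun x _ => p0 x) (fun x _ => q0 x).
rewrite !rsumK// -EFinB /rsum => e; rewrite -fineB; first by rewrite e.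
- have := summable_funepos sb; rewrite summableE.
  by under eq_esum => x _ do rewrite gee0_abs ?funepos_ge0//.
- have := summable_funeneg sb; rewrite summableE.
  by under eq_esum => x _ do rewrite gee0_abs ?funeneg_ge0//.
Qed.

Lemma rsumD_ge0 p q : (forall x, 0 <= p x) -> (forall x, 0 <= q x) ->
  rsummable p -> rsummable q -> rsum (fun x => p x + q x) = rsum p + rsum q.
Proof.
move=> p0 q0 sp sq; apply: EFin_inj.
rewrite -rsumK; last exact: rsummableD; last by move=> x; rewrite addr_ge0.
by rewrite EFinD -(rsumK p0 sp) -(rsumK q0 sq) -esumD// => x _; rewrite lee_fin.
Qed.

(** Real-valued positive and negative parts, through which linearity is reduced to nonnegative
    families. *)
Let hp h x := Num.max (h x) 0.
Let hn h x := Num.max (- h x) 0.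
Let hpE h x : h x = hp h x - hn h x.
Proof. by rewrite /hp /hn; case: leP => ?; case: leP => ?; lra. Qed.
Let hp0 h x : 0 <= hp h x. Proof. by rewrite le_max lexx orbT. Qed.
Let hn0 h x : 0 <= hn h x. Proof. by rewrite le_max lexx orbT. Qed.
Let rsummable_norm h : rsummable h -> rsummable (fun x => `|h x|).
Proof.
rewrite /rsummable /summable; apply: le_lt_trans; apply: le_esum => x _.
by rewrite /= normr_id.
Qed.
Let hps h : rsummable h -> rsummable (hp h).
Proof.
move=> /rsummable_norm; apply: rsummable_le => x; rewrite ger0_norm// /hp.
by rewrite ge_max ler_norm normr_ge0.
Qed.
Let hns h : rsummable h -> rsummable (hn h).
Proof.
move=> /rsummable_norm; apply: rsummable_le => x; rewrite ger0_norm// /hn.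
by rewrite ge_max -normrN ler_norm normr_ge0.
Qed.
Let rsum_hpn h : rsummable h -> rsum h = rsum (hp h) - rsum (hn h).
Proof.
move=> sh; rewrite -(rsumB_ge0 (hp0 h) (hn0 h) (hps sh) (hns sh)).
by congr rsum; apply/funext => x; exact: hpE.
Qed.

Lemma rsumD h p : rsummable h -> rsummable p ->
  rsum (fun x => h x + p x) = rsum h + rsum p.
Proof.
move=> sh sp.
rewrite (_ : (fun x => _) = fun x => (hp h x + hp p x) - (hn h x + hn p x)); last first.
  by apply/funext => x; rewrite {1}(hpE h) {1}(hpE p); ring.
have [[h1 h2] [p1 p2]] := ((hps sh, hns sh), (hps sp, hns sp)).
rewrite rsumB_ge0 ?rsumD_ge0//; first last.
- exact: rsummableD.
- exact: rsummableD.
- by move=> x; rewrite addr_ge0.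
- by move=> x; rewrite addr_ge0.
by rewrite (rsum_hpn sh) (rsum_hpn sp); ring.
Qed.

Lemma rsumN h : rsum (fun x => - h x) = - rsum h.
Proof.
rewrite /rsum opprB; congr (_ - _); congr fine; apply: eq_esum => x _.
  by rewrite -(funeposN (EFin \o h)).
by rewrite -(funenegN (EFin \o h)).
Qed.

Lemma rsumB h p : rsummable h -> rsummable p ->
  rsum (fun x => h x - p x) = rsum h - rsum p.
Proof. by move=> sh sp; rewrite rsumD ?rsumN//; exact: rsummableN. Qed.

Lemma rsum_ge0 h : (forall x, 0 <= h x) -> 0 <= rsum h.
Proof.
by move=> h0; rewrite esum_rsum// fine_ge0// esum_ge0// => x _; rewrite lee_fin.
Qed.

Lemma le_rsum h p : rsummable h -> rsummable p -> (forall x, h x <= p x) ->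
  rsum h <= rsum p.
Proof.
by move=> sh sp hp'; rewrite -subr_ge0 -rsumB// rsum_ge0// => x; rewrite subr_ge0.
Qed.

Lemma rsum0 : rsum (fun _ : T => 0 : R) = 0.
Proof. by rewrite esum_rsum// esum1. Qed.

Let rsumZ_ge0 (c : R) h : 0 <= c -> (forall x, 0 <= h x) ->
  rsum (fun x => c * h x) = c * rsum h.
Proof.
move=> c0 h0; rewrite !esum_rsum//; last by move=> x; rewrite mulr_ge0.
rewrite (_ : esum _ _ = c%:E * esum [set: T] (EFin \o h))%E; last exact: esumZ.
have := esum_ge0 (fun x (_ : [set: T] x) => (h0 x : (0 <= (EFin \o h) x)%E)).
case: (esum _ _) => [r||] //= _; have [->|c0'] := eqVneq c 0.
  by rewrite mul0e mul0r.
by rewrite gt0_muley ?mulr0// lte_fin lt_neqAle eq_sym c0'.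
Qed.

Lemma rsummableZ (c : R) h : rsummable h -> rsummable (fun x => c * h x).
Proof.
move=> sh.
have : rsummable (fun x => `|c| * `|h x|).
  apply/rsummable_fin => [x|]; first by rewrite mulr_ge0.
  rewrite (_ : esum _ _ =
    `|c|%:E * esum [set: T] (EFin \o (fun x => `|h x|%R)))%E; last first.
    exact: esumZ.
  by rewrite fin_numM//; apply/rsummable_fin => //; exact: rsummable_norm.
by apply: rsummable_le => x; rewrite normrM.
Qed.

Lemma rsumZ (c : R) h : rsummable h -> rsum (fun x => c * h x) = c * rsum h.
Proof.
wlog c0 : c / 0 <= c.
  move=> H sh; have [/H|c0] := leP 0 c; first exact.
  rewrite -[LHS]opprK -rsumN.
  rewrite (_ : (fun x => _) = fun x => (- c) * h x).
    by rewrite H//; [ring | rewrite oppr_ge0 ltW].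
  by apply/funext => x; rewrite mulNr.
move=> sh; rewrite (rsum_hpn sh) mulrBr -!rsumZ_ge0// -rsumB_ge0.
- by congr rsum; apply/funext => x; rewrite {1}(hpE h) mulrBr.
- by move=> x; rewrite mulr_ge0.
- by move=> x; rewrite mulr_ge0.
- exact/rsummableZ/hps.
- exact/rsummableZ/hns.
Qed.

Lemma rsummable_sum (I : Type) (r : seq I) (P : pred I) (F : I -> T -> R) :
  (forall i, rsummable (F i)) -> rsummable (fun x => \sum_(i <- r | P i) F i x).
Proof.
move=> sF; elim: r => [|i r IH].
  rewrite (_ : (fun x => _) = fun=> 0); last by apply/funext => x; rewrite big_nil.
  by rewrite /rsummable /summable esum1// => x _; rewrite /= normr0.
rewrite (_ : (fun x => _) =
  fun x => (if P i then 1 else 0) * F i x + \sum_(i <- r | P i) F i x).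
  by apply: rsummableD => //; exact: rsummableZ.
by apply/funext => x; rewrite big_cons; case: ifP; rewrite ?mul1r// mul0r add0r.
Qed.

Lemma rsum_sum (I : Type) (r : seq I) (P : pred I) (F : I -> T -> R) :
  (forall i, rsummable (F i)) ->
  rsum (fun x => \sum_(i <- r | P i) F i x) = \sum_(i <- r | P i) rsum (F i).
Proof.
move=> sF; elim: r => [|i r IH].
  by rewrite big_nil -[RHS]rsum0; congr rsum; apply/funext => x; rewrite big_nil.
rewrite (_ : (fun x => _) =
  fun x => (if P i then 1 else 0) * F i x + \sum_(i <- r | P i) F i x).
  rewrite rsumD; last exact: rsummable_sum; last exact: rsummableZ.
  by rewrite rsumZ// IH big_cons; case: ifP; rewrite ?mul1r// mul0r add0r.
by apply/funext => x; rewrite big_cons; case: ifP; rewrite ?mul1r// mul0r add0r.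
Qed.

End RealSum.

Section Reindex.
Variables (R : realType) (T : choiceType) (e : T -> T).
Hypothesis bije : set_bij [set: T] [set: T] e.

Lemma rsum_reindex (h : T -> R) : rsum (fun x => h (e x)) = rsum h.
Proof.
rewrite /rsum; congr (fine _ - fine _); rewrite [RHS](reindex_esum _ _ _ _ bije);
  apply: eq_esum => x _.
  by rewrite !funeposE.
by rewrite !funenegE.
Qed.

Lemma rsummable_reindex (h : T -> R) : rsummable h -> rsummable (fun x => h (e x)).
Proof. by rewrite /rsummable /summable (reindex_esum _ _ _ _ bije). Qed.

End Reindex.

Section Conjugation.
Variable R : realType.
Implicit Types z w : R[i].

Lemma conjcD z w : conjc (z + w) = conjc z + conjc w.
Proof. exact: rmorphD. Qed.

Lemma conjcM z w : conjc (z * w) = conjc z * conjc w.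
Proof. exact: rmorphM. Qed.

Lemma conjcN z : conjc (- z) = - conjc z.
Proof. exact: rmorphN. Qed.

End Conjugation.

Section ComplexSum.
Variables (R : realType) (T : choiceType).
Implicit Types (h k : T -> R[i]).

Definition csummable h :=
  rsummable (fun x => complex.Re (h x)) /\ rsummable (fun x => complex.Im (h x)).

Lemma csumD h k : csummable h -> csummable k ->
  csum (fun x => h x + k x) = csum h + csum k.
Proof.
move=> [h1 h2] [k1 k2]; rewrite /csum.
rewrite -[RHS]/(Complex (rsum _ + rsum _) (rsum _ + rsum _)) -!rsumD//.
by congr Complex; congr rsum; apply/funext => x; case: (h x) (k x) => [a b] [c d].
Qed.

Lemma csumZ (c : R[i]) h : csummable h -> csum (fun x => c * h x) = c * csum h.
Proof.
case: c => a b [h1 h2]; rewrite /csum.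
rewrite -[RHS]/(Complex (a * rsum _ - b * rsum _) (a * rsum _ + b * rsum _)).
rewrite -!rsumZ// -rsumB ?rsummableZ// -rsumD ?rsummableZ//.
by congr Complex; congr rsum; apply/funext => x; case: (h x) => [c d].
Qed.

Lemma csum_conj h : csum (fun x => conjc (h x)) = conjc (csum h).
Proof.
rewrite /csum /= -rsumN.
by congr Complex; congr rsum; apply/funext => x; case: (h x) => [c d].
Qed.

End ComplexSum.

(** * Hilbert space and operator norm *)

Section InnerProduct.
Variables (R : realType) (T : choiceType).
Implicit Types (f g h : l2 R T) (c : R[i]).

Lemma normc_sq (z : R[i]) :
  Normc.normc z ^+ 2 = complex.Re z ^+ 2 + complex.Im z ^+ 2.
Proof. by case: z => a b /=; rewrite sqr_sqrtr// addr_ge0// sqr_ge0. Qed.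

Lemma l2_summable f : rsummable (fun x => Normc.normc (f x) ^+ 2).
Proof.
by apply/rsummable_fin => [x|]; [rewrite sqr_ge0 | exact/l2_predP/l2_funP].
Qed.

(** By AM-GM the real and imaginary parts of each term are at most [|f x|^2 + |g x|^2] in absolute
    value. *)
Lemma l2dot_csummable f g : csummable (fun x => f x * conjc (g x)).
Proof.
by split; apply: rsummable_le (rsummableD (l2_summable f) (l2_summable g)) => x;
  rewrite !normc_sq; case: (f x) (g x) => [a b] [c d] /=;
  have := (sqr_ge0 (a + c), sqr_ge0 (a - c), sqr_ge0 (b + d), sqr_ge0 (b - d));
  have := (sqr_ge0 (a + d), sqr_ge0 (a - d), sqr_ge0 (b + c), sqr_ge0 (b - c));
  move=> [[[h1 h2] h3] h4] [[[h5 h6] h7] h8];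
  rewrite ler_norml; apply/andP; split; nra.
Qed.

Lemma l2dotDl f g h : l2dot (f + g) h = l2dot f h + l2dot g h.
Proof.
rewrite /l2dot -csumD; [|exact: l2dot_csummable..].
by congr csum; apply/funext => x; rewrite -mulrDl.
Qed.

Lemma l2dotZl c f g : l2dot (c *: f) g = c * l2dot f g.
Proof.
rewrite /l2dot -csumZ; last exact: l2dot_csummable.
by congr csum; apply/funext => x; rewrite mulrA.
Qed.

Lemma l2dotC f g : l2dot g f = conjc (l2dot f g).
Proof.
rewrite /l2dot -csum_conj; congr csum; apply/funext => x.
by rewrite conjcM conjcK mulrC.
Qed.

Lemma l2dotDr f g h : l2dot f (g + h) = l2dot f g + l2dot f h.
Proof. by rewrite l2dotC l2dotDl conjcD -!l2dotC. Qed.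

Lemma l2dotZr c f g : l2dot f (c *: g) = conjc c * l2dot f g.
Proof. by rewrite l2dotC l2dotZl conjcM -l2dotC. Qed.

Lemma l2dot0l f : l2dot 0 f = 0.
Proof. by rewrite -[0 in LHS](scale0r 0) l2dotZl mul0r. Qed.

Lemma l2dot0r f : l2dot f 0 = 0.
Proof. by rewrite l2dotC l2dot0l conjc0. Qed.

Lemma l2dotNl f g : l2dot (- f) g = - l2dot f g.
Proof. by rewrite -scaleN1r l2dotZl mulN1r. Qed.

Lemma l2dotNr f g : l2dot f (- g) = - l2dot f g.
Proof. by rewrite l2dotC l2dotNl conjcN -l2dotC. Qed.

Lemma l2dot_suml (I : Type) (r : seq I) (P : pred I) (F : I -> l2 R T) g :
  l2dot (\sum_(i <- r | P i) F i) g = \sum_(i <- r | P i) l2dot (F i) g.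
Proof.
by apply: (big_morph (fun f => l2dot f g)) => [f h|]; [exact: l2dotDl|exact: l2dot0l].
Qed.

Lemma l2dot_sumr (I : Type) (r : seq I) (P : pred I) (F : I -> l2 R T) g :
  l2dot g (\sum_(i <- r | P i) F i) = \sum_(i <- r | P i) l2dot g (F i).
Proof.
by apply: (big_morph (fun f => l2dot g f)) => [f h|]; [exact: l2dotDr|exact: l2dot0r].
Qed.

Lemma l2norm_rsum f : l2norm f ^+ 2 = rsum (fun x => Normc.normc (f x) ^+ 2).
Proof.
apply: EFin_inj; rewrite l2norm_sqr /sqsum.
rewrite -(@rsumK R T (fun x => Normc.normc (f x) ^+ 2))//; last exact: l2_summable.
by move=> x; rewrite sqr_ge0.
Qed.

Lemma l2dotE f : l2dot f f = (l2norm f ^+ 2)%:C%C.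
Proof.
rewrite l2norm_rsum /l2dot /csum; congr Complex.
  congr rsum; apply/funext => x; rewrite normc_sq.
  by case: (f x) => a b /=; ring.
rewrite -[RHS](@rsum0 R T); congr rsum; apply/funext => x.
by case: (f x) => a b /=; ring.
Qed.

Lemma l2norm_eq0 f : l2norm f = 0 -> f = 0.
Proof.
move=> f0; apply: val_inj; apply/funext => x /=; apply: Normc.eq0_normc.
have : ((Normc.normc (f x) ^+ 2)%:E <= 0)%E.
  have <- : sqsum f = 0%E by rewrite -l2norm_sqr f0 expr0n.
  rewrite /sqsum (esumID [set x])//; last by move=> y _; rewrite lee_fin sqr_ge0.
  rewrite setTI esum_set1 ?lee_fin ?sqr_ge0// leeDl// esum_ge0// => y _.
  by rewrite lee_fin sqr_ge0.
by rewrite lee_fin => le0; apply/eqP; rewrite -sqrf_eq0 eq_le le0 sqr_ge0.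
Qed.

Lemma l2norm_dot f : l2norm f ^+ 2 = complex.Re (l2dot f f).
Proof. by rewrite l2dotE. Qed.

Lemma l2normZ c f : l2norm (c *: f) = Normc.normc c * l2norm f.
Proof.
have c0 : 0 <= Normc.normc c by case: c => a b; exact: sqrtr_ge0.
apply/eqP; rewrite -(eqrXn2 (n := 2))// ?mulr_ge0 ?l2norm_ge0//; apply/eqP.
apply: complexI; rewrite -l2dotE l2dotZl l2dotZr l2dotE exprMn normc_sq.
case: c {c0} => a b; move: (l2norm f ^+ 2) => u.
by apply/eqP; rewrite eq_complex /=; apply/andP; split; apply/eqP; ring.
Qed.

End InnerProduct.

Section OperatorNorm.
Variables (R : realType) (T : choiceType).
Implicit Types (S P : l2op R T) (f : l2 R T).

Lemma l2norm0 : l2norm (0 : l2 R T) = 0.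
Proof. by apply/eqP; rewrite -sqrf_eq0 l2norm_dot l2dot0l. Qed.

Lemma normc_real (a : R) : Normc.normc a%:C%C = `|a|.
Proof. by rewrite /= expr0n addr0 sqrtr_sqr. Qed.

Lemma l2norm_op_le S f : l2norm (S f) <= opnorm S * l2norm f.
Proof.
have [M HM] := l2opP S.
have [/l2norm_eq0->|f0] := eqVneq (l2norm f) 0.
  by rewrite linear0 l2norm0 mulr0.
have fp : 0 < l2norm f by rewrite lt_neqAle eq_sym f0 l2norm_ge0.
have : l2norm (S (((l2norm f)^-1)%:C%C *: f)) <= opnorm S.
  apply: sup_upper_bound.
    split; first by exists (l2norm (S 0)), 0 => //=; rewrite l2norm0.
    (* [M] is not known to be nonnegative, hence the absolute value. *)
    exists `|M| => _ [g /= g1 <-]; apply: le_trans (HM g) _.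
    rewrite (le_trans (ler_wpM2r (l2norm_ge0 _) (ler_norm M)))//.
    by rewrite -[leRHS]mulr1 ler_wpM2l.
  exists (((l2norm f)^-1)%:C%C *: f) => //=.
  by rewrite l2normZ normc_real ger0_norm ?invr_ge0 ?l2norm_ge0// mulVf.
rewrite linearZ l2normZ normc_real ger0_norm ?invr_ge0 ?l2norm_ge0//.
by rewrite mulrC ler_pdivrMr.
Qed.

Lemma opnorm_le S (M : R) : 0 <= M -> (forall f, l2norm (S f) <= M * l2norm f) ->
  opnorm S <= M.
Proof.
move=> M0 HM; apply: ge_sup; first by exists (l2norm (S 0)), 0 => //=; rewrite l2norm0.
move=> _ [g /= g1 <-]; apply: le_trans (HM g) _.
by rewrite -[leRHS]mulr1 ler_wpM2l.
Qed.

Lemma opnorm_ge0 S : 0 <= opnorm S.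
Proof.
(* The operator bound yields the sign after division by a nonzero norm; the zero space is treated
   apart. *)
have [[f f0]|H] := pselect (exists f, l2norm f != 0).
  have := le_trans (l2norm_ge0 _) (l2norm_op_le S f).
  by rewrite pmulr_lge0// lt_neqAle eq_sym f0 l2norm_ge0.
apply: sup_upper_bound.
  split; first by exists (l2norm (S 0)), 0 => //=; rewrite l2norm0.
  exists 0 => _ [g _ <-]; apply: le_trans (l2norm_op_le S g) _.
  have [->|g0] := eqVneq (l2norm g) 0; first by rewrite mulr0.
  by exfalso; apply: H; exists g.
by exists 0; rewrite /= ?linear0 l2norm0.
Qed.

End OperatorNorm.

(** * Translation invariance of the inner product *)

Section RegularRepresentation.
Variables (R : realType) (G : groupType).
Implicit Types (s : G) (f g : l2 R G).

Lemma bij_mulgl s : set_bij [set: G] [set: G] (fun t => s * t)%g.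
Proof.
split=> //; first by move=> x y _ _; exact: mulgI.
by move=> y _; exists (s^-1 * y)%g => //; rewrite mulVKg.
Qed.

Lemma bij_mulgr s : set_bij [set: G] [set: G] (fun t => t * s)%g.
Proof.
split=> //; first by move=> x y _ _; exact: mulIg.
by move=> y _; exists (y * s^-1)%g => //; rewrite mulgVK.
Qed.

(** Stated for an arbitrary bijection of [G], it serves left and right translations alike. *)
Lemma l2dot_reindex (e : G -> G) f g f' g' : set_bij [set: G] [set: G] e ->
  (forall t, f' t = f (e t)) -> (forall t, g' t = g (e t)) ->
  l2dot f' g' = l2dot f g.
Proof.
move=> bije ff gg; rewrite /l2dot /csum; congr Complex.
  rewrite -[RHS](rsum_reindex bije); congr rsum; apply/funext => t.
  by rewrite ff gg.
rewrite -[RHS](rsum_reindex bije); congr rsum; apply/funext => t.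
by rewrite ff gg.
Qed.

Lemma l2dot_lreg s f g : l2dot (lreg R s f) (lreg R s g) = l2dot f g.
Proof. exact: (l2dot_reindex (bij_mulgl s^-1)). Qed.

Lemma l2norm_lreg s f : l2norm (lreg R s f) = l2norm f.
Proof.
by apply/eqP; rewrite -(eqrXn2 (n := 2))// ?l2norm_ge0// !l2norm_dot l2dot_lreg.
Qed.

Lemma l2dot_disjoint f g : (forall t, f t = 0 \/ g t = 0) -> l2dot f g = 0.
Proof.
move=> fg; rewrite /l2dot /csum.
by congr Complex; rewrite -[RHS](@rsum0 R G); congr rsum; apply/funext => t;
  case: (fg t) => ->; rewrite ?conjc0 ?mul0r ?mulr0.
Qed.

Lemma l2norm_delta s : l2norm (delta R s) = 1.
Proof.
apply/eqP; rewrite -(eqrXn2 (n := 2))// ?l2norm_ge0// expr1n; apply/eqP/EFin_inj.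
rewrite l2norm_sqr /sqsum (esumID [set s])//; last first.
  by move=> x _; rewrite lee_fin sqr_ge0.
rewrite setTI setTI esum_set1 ?lee_fin ?sqr_ge0// esum1 ?adde0/=.
  by rewrite /delta_fun eqxx Normc.normc1 expr1n.
by move=> x /= /eqP/negPf xt; rewrite /delta_fun xt Normc.normc0 expr0n.
Qed.

End RegularRepresentation.

(** * Orthonormal families and compressions to their span *)

Section Orthonormal.
Variables (R : realType) (T : choiceType).
Implicit Types (f g : l2 R T).

Definition orthonormal_family n (q : 'I_n -> l2 R T) :=
  forall i j, l2dot (q i) (q j) = (i == j)%:R.

Lemma l2_sumE (I : Type) (r : seq I) (F : I -> l2 R T) t :
  (\sum_(i <- r) F i) t = \sum_(i <- r) F i t.
Proof. by elim: r => [|i r IH]; rewrite ?big_nil// !big_cons -IH. Qed.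

Lemma l2dot_sum_orthonormal n (q : 'I_n -> l2 R T) (c : 'I_n -> R[i]) j :
  orthonormal_family q -> l2dot (\sum_i c i *: q i) (q j) = c j.
Proof.
move=> oq; rewrite l2dot_suml (bigD1 j)//= big1 ?addr0.
  by rewrite l2dotZl oq eqxx mulr1.
by move=> i /negPf ij; rewrite l2dotZl oq ij mulr0.
Qed.

Lemma Re_sum (I : Type) (r : seq I) (F : I -> R[i]) :
  complex.Re (\sum_(i <- r) F i) = \sum_(i <- r) complex.Re (F i).
Proof.
elim: r => [|i r IH]; rewrite ?big_nil// !big_cons -IH.
by case: (F i) (\sum_(_ <- _) _) => [a b] [c d].
Qed.

Lemma l2norm_sum_orthonormal n (q : 'I_n -> l2 R T) (c : 'I_n -> R[i]) :
  orthonormal_family q -> l2norm (\sum_i c i *: q i) ^+ 2 = \sum_i Normc.normc (c i) ^+ 2.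
Proof.
move=> oq; rewrite l2norm_dot l2dot_sumr Re_sum; apply: eq_bigr => i _.
rewrite l2dotZr l2dot_sum_orthonormal// normc_sq.
by case: (c i) => a b /=; ring.
Qed.

(** No independence is assumed, so [m] may be smaller than [n]. The last clause is the form in which
    membership of the [q j] in the span of the [e i] is used. *)
Lemma gram_schmidt n (e : 'I_n -> l2 R T) :
  exists m (q : 'I_m -> l2 R T),
    [/\ orthonormal_family q,
        forall i, e i = \sum_j l2dot (e i) (q j) *: q j &
        forall P : {linear l2 R T -> l2 R T},
          (forall i, P (e i) = e i) -> forall j, P (q j) = q j].
Proof.
elim: n e => [|n IH] e.
  exists 0, (fun=> 0); split=> [[]//|[]//|? ? []//].
have [m [q [oq eq qP]]] := IH (fun i => e (lift ord_max i)).
(* The last vector minus its projection; it is normalised and added to [q] unless it vanishes. *)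
pose w := e ord_max - \sum_j l2dot (e ord_max) (q j) *: q j.
have wq j : l2dot w (q j) = 0.
  by rewrite l2dotDl l2dotNl l2dot_sum_orthonormal// subrr.
have qw j : l2dot (q j) w = 0 by rewrite l2dotC wq conjc0.
have wP (P : {linear l2 R T -> l2 R T}) : (forall i, P (e i) = e i) -> P w = w.
  move=> Pe; rewrite linearB linear_sum Pe; congr (_ - _).
  by apply: eq_bigr => j _; rewrite linearZ/= qP.
have [w0|w0] := eqVneq (l2norm w) 0.
  exists m, q; split=> // [i|P Pe]; last by apply: qP => i; exact: Pe.
  have [j ->|->] := unliftP ord_max i; first exact: eq.
  by apply/eqP; rewrite -subr_eq0; apply/eqP/l2norm_eq0.
pose u := ((l2norm w)^-1)%:C%C *: w.
pose q' (i : 'I_m.+1) := if unlift ord_max i is Some j then q j else u.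
have q'l j : q' (lift ord_max j) = q j by rewrite /q' liftK.
have q'm : q' ord_max = u by rewrite /q' unlift_none.
exists m.+1, q'; split.
- have uq j : l2dot u (q j) = 0 by rewrite l2dotZl wq mulr0.
  move=> i j.
  have [i' ->|->] := unliftP ord_max i; have [j' ->|->] := unliftP ord_max j;
    rewrite ?q'l ?q'm.
  + by rewrite oq (inj_eq lift_inj).
  + by rewrite l2dotC uq conjc0 eq_sym (negPf (neq_lift _ _)).
  + by rewrite uq (negPf (neq_lift _ _)).
  + rewrite eqxx l2dotZl l2dotZr l2dotE conjc_real -!rmorphM/=.
    by rewrite expr2 mulKf// mulVf.
- move=> i; rewrite (bigD1_ord ord_max)//= q'm.
  under eq_bigr => j _ do rewrite q'l.
  have [j ->|->] := unliftP ord_max i.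
    suff eu : l2dot (e (lift ord_max j)) u = 0 by rewrite -eq eu scale0r add0r.
    rewrite eq l2dotZr l2dot_suml big1 ?mulr0// => k _.
    by rewrite l2dotZl qw mulr0.
  have ->: l2dot (e ord_max) u *: u = w.
    have -> : e ord_max = w + \sum_j l2dot (e ord_max) (q j) *: q j by rewrite subrK.
    rewrite l2dotDl l2dot_suml [X in _ + X]big1 ?addr0; last first.
      by move=> k _; rewrite l2dotZl l2dotZr qw !mulr0.
    rewrite l2dotZr l2dotE scalerA conjc_real -!rmorphM/=.
    by rewrite expr2 mulKf// mulfV// scale1r.
  by rewrite subrK.
- move=> P Pe j; have [j' ->|->] := unliftP ord_max j; rewrite ?q'l ?q'm.
    by apply: qP => i; exact: Pe.
  by rewrite linearZ/= wP.
Qed.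

Lemma projection_orthonormal (P : l2op R T) n : is_projection P -> has_rank P n ->
  exists m (q : 'I_m -> l2 R T),
    orthonormal_family q /\ forall f, P f = \sum_j l2dot f (q j) *: q j.
Proof.
move=> [PP Padj] [e [_ rPe]].
have Pe i : P (e i) = e i.
  have : range P (e i).
    rewrite rPe; exists (fun j => (j == i)%:R) => //.
    rewrite (bigD1 i)//= eqxx scale1r big1 ?addr0// => j /negPf ->.
    by rewrite scale0r.
  by move=> [f _ <-].
have [m [q [oq eq qP]]] := gram_schmidt e.
exists m, q; split=> // f.
have [c _ Pf] : range (fun c : 'I_n -> R[i] => \sum_i c i *: e i) (P f).
  by rewrite -rPe; exists f.
(* Self-adjointness and [P (q j) = q j] replace [P f] by [f] in the coefficients; what remains is to
   expand [P f], a combination of the [e i]. *)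
transitivity (\sum_j l2dot (P f) (q j) *: q j); last first.
  by apply: eq_bigr => j _; rewrite Padj qP.
rewrite -Pf; under [in RHS]eq_bigr => j _ do rewrite l2dot_suml scaler_suml.
rewrite exchange_big/=; apply: eq_bigr => i _; rewrite [in LHS]eq scaler_sumr.
by apply: eq_bigr => j _; rewrite l2dotZl scalerA.
Qed.

(* The matrix of [P U] on the range of [P] is bounded below by [s], so its
   inverse scaled by [s] is a contraction whose pairing with it has trace [s n]. *)
Lemma dual_contraction (U P : l2op R T) n (q : 'I_n -> l2 R T) (s : R) : 0 < s ->
  orthonormal_family q -> (forall f, P f = \sum_j l2dot f (q j) *: q j) ->
  (forall f, P f = f -> s * l2norm f <= l2norm (P (U f))) ->
  exists p : 'I_n -> l2 R T,
    \sum_i l2dot (U (q i)) (p i) = (s * n%:R)%:C%C /\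
    forall t, \sum_i Normc.normc (p i t) ^+ 2 <= \sum_i Normc.normc (q i t) ^+ 2.
Proof.
move=> s0 oq PE sP.
pose A : 'M[R[i]]_n := \matrix_(i, j) l2dot (U (q i)) (q j).
pose nv (x : 'rV[R[i]]_n) := \sum_i Normc.normc (x 0 i) ^+ 2.
(* Rows are coordinate vectors: if [f] has coordinates [x], then [P (U f)] has coordinates
   [x *m A]. *)
have normA (x : 'rV_n) : s ^+ 2 * nv x <= nv (x *m A).
  pose f := \sum_i x 0 i *: q i.
  have Pf : P f = f.
    by rewrite PE; apply: eq_bigr => j _; rewrite l2dot_sum_orthonormal.
  have PUf : P (U f) = \sum_j (x *m A) 0 j *: q j.
    rewrite PE; apply: eq_bigr => j _; congr (_ *: _).
    rewrite linear_sum l2dot_suml mxE; apply: eq_bigr => i _.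
    by rewrite linearZ/= l2dotZl mxE.
  have := sP f Pf; rewrite PUf => le_norm.
  rewrite /nv -(l2norm_sum_orthonormal _ oq) -(l2norm_sum_orthonormal _ oq) -exprMn.
  by rewrite lerXn2r ?nnegrE ?mulr_ge0 ?l2norm_ge0// ltW.
have nv0 (x : 'rV_n) : nv x <= 0 -> x = 0.
  move=> x0; apply/rowP => i; rewrite mxE; apply: Normc.eq0_normc; apply/eqP.
  rewrite -sqrf_eq0 eq_le sqr_ge0 andbT (le_trans _ x0)// /nv (bigD1 i)//=.
  by rewrite lerDl sumr_ge0// => j _; rewrite sqr_ge0.
have uA : A \in unitmx.
  rewrite -row_free_unit -kermx_eq0; apply/rowV0P => x /sub_kermxP xA.
  apply: nv0; have := normA x; rewrite xA.
  rewrite [X in _ <= X]big1; last by move=> i _; rewrite mxE Normc.normc0 expr0n.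
  by rewrite pmulr_rle0// exprn_gt0.
pose B := s%:C%C *: invmx A.
have normB (y : 'rV_n) : nv (y *m B) <= nv y.
  have := normA (y *m invmx A); rewrite mulmxKV//; apply: le_trans.
  rewrite -scalemxAr /nv mulr_sumr; apply: ler_sum => i _.
  by rewrite mxE Normc.normcM exprMn normc_real real_normK ?num_real.
(* The pairing with these vectors is the trace of [A *m B], which is [s] times the identity matrix.
   At each [t], the conjugates of the values [p i t] form the row of the conjugates of the [q j t]
   multiplied by [B], so the contraction bound holds pointwise. *)
exists (fun i => \sum_j conjc (B j i) *: q j); split.
  transitivity (\tr (A *m B)).
    apply: eq_bigr => i _; rewrite mxE l2dot_sumr; apply: eq_bigr => j _.
    by rewrite l2dotZr conjcK [A i j]mxE mulrC.
  rewrite -scalemxAr mulmxV// scale_scalar_mx mulr1 mxtrace_scalar.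
  by rewrite mulr_natr -(rmorphMn (real_complex R)).
move=> t; have := normB (\row_j conjc (q j t)).
have normcJ (z : R[i]) : Normc.normc (conjc z) = Normc.normc z.
  by case: z => a b /=; rewrite sqrrN.
rewrite /nv; congr (_ <= _); apply: eq_bigr => i _; last by rewrite mxE normcJ.
congr (_ ^+ 2); rewrite l2_sumE -normcJ; congr Normc.normc.
rewrite mxE (big_morph _ (@conjcD R) (@conjc0 R)); apply: eq_bigr => j _.
by rewrite [(\row__ _) _ _]mxE conjcM conjcK mulrC.
Qed.

End Orthonormal.

(** * Kesten's inequality and the lower bound *)

Section Kesten.
Variable R : realType.

Lemma letter_reduced (l : letter) : reduced [:: l].
Proof. by []. Qed.

Definition gen (l : letter) : F2 := MkF2 (letter_reduced l).

Definition starts (l : letter) (t : F2) : bool := ohead t == Some l.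

(** Multiplication by [gen l] prepends [l] or cancels a leading [linv l]; after a cancellation the
    next letter is not [l], because [t] is reduced. *)
Lemma starts_gen l t : starts l (gen l * t)%g = ~~ starts (linv l) t.
Proof.
rewrite /starts; case: t => [[|h r]] rt /=; first by rewrite eqxx.
rewrite (inj_eq Some_inj); case: ifPn => [/eqP hl|_]; last by rewrite /= eqxx.
case: r rt => [|k r] //=; rewrite hl linvK => /andP[/negPf kl _].
by apply/negP; rewrite (inj_eq Some_inj) kl.
Qed.

Let k : R := Num.sqrt 3.
Let k0 : 0 < k. Proof. by rewrite sqrtr_gt0. Qed.
Let kk : k * k = 3. Proof. by rewrite -expr2 sqr_sqrtr. Qed.

(** The weight at [t] of the edge joining [t] to [(gen l)^-1 * t], which is the parent of [t]
    exactly when [starts l t]. The two weights on an edge have product 1/4. *)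
Definition weight l t : R := if starts l t then k / 2 else k / 6.

(* Each vertex of the Cayley tree has at most one edge leading to its parent,
   which carries the large weight. *)
Lemma sum_weight t :
  weight (false, false) t + weight (false, true) t +
  (weight (true, false) t + weight (true, true) t) <= k.
Proof.
rewrite /weight /starts; case: (ohead t) => [[[] []]|] /=; move: k0; lra.
Qed.

(** Here [w] sits at [t] and [z] at the other end of the edge. Since the weights have product 1/4,
    the difference of the two sides is a combination of squares. *)
Lemma weight_am_gm l t (z w : R[i]) :
  complex.Re (z * conjc w) <=
  (if starts l t then k / 6 else k / 2) * Normc.normc z ^+ 2 +
  weight l t * Normc.normc w ^+ 2.
Proof.
have kge0 := ltW k0.
rewrite /weight !normc_sq; case: z w => [a b] [c d] /=.
have sq x : 0 <= k / 2 * x ^+ 2 by rewrite mulr_ge0 ?sqr_ge0 ?divr_ge0.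
case: ifP => _; rewrite -subr_ge0.
  suff -> : k / 6 * (a ^+ 2 + b ^+ 2) + k / 2 * (c ^+ 2 + d ^+ 2) -
      (a * c - b * - d) = k / 2 * (c - k / 3 * a) ^+ 2 + k / 2 * (d - k / 3 * b) ^+ 2.
    exact: addr_ge0.
  (* The factor [k * k] is isolated so that [kk] can replace it; the remaining identity is
     rational. *)
  have -> : k / 2 * (c - k / 3 * a) ^+ 2 + k / 2 * (d - k / 3 * b) ^+ 2 =
    k / 2 * (c ^+ 2 + d ^+ 2) - (k * k) / 3 * (a * c + b * d) +
    (k * k) / 3 * (k / 6 * (a ^+ 2 + b ^+ 2)) by field.
  by rewrite kk; field.
suff -> : k / 2 * (a ^+ 2 + b ^+ 2) + k / 6 * (c ^+ 2 + d ^+ 2) -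
    (a * c - b * - d) = k / 2 * (a - k / 3 * c) ^+ 2 + k / 2 * (b - k / 3 * d) ^+ 2.
  exact: addr_ge0.
have -> : k / 2 * (a - k / 3 * c) ^+ 2 + k / 2 * (b - k / 3 * d) ^+ 2 =
  k / 2 * (a ^+ 2 + b ^+ 2) - (k * k) / 3 * (a * c + b * d) +
  (k * k) / 3 * (k / 6 * (c ^+ 2 + d ^+ 2)) by field.
by rewrite kk; field.
Qed.

Section Family.
Variables (n : nat) (q : 'I_n -> l2 R F2).

(** For orthonormal [q] this is the diagonal of the projection onto their span. *)
Let H t := \sum_i Normc.normc (q i t) ^+ 2.

Let H_ge0 t : 0 <= H t.
Proof. by apply: sumr_ge0 => i _; rewrite sqr_ge0. Qed.

Let H_summable : rsummable H.
Proof. by apply: rsummable_sum => i; exact: l2_summable. Qed.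

Let weight_ge0 l t : 0 <= weight l t.
Proof. by rewrite /weight; case: ifP => _; rewrite divr_ge0 ?ltW. Qed.

Let weight_le l t : weight l t <= k.
Proof. by rewrite /weight; case: ifP => _; move: k0; lra. Qed.

Let weight_summable l : rsummable (fun t => weight l t * H t).
Proof.
apply: rsummable_le (rsummableZ k H_summable) => t.
by rewrite ger0_norm ?mulr_ge0// ler_wpM2r.
Qed.

(** The term at [t] belongs to the edge from [x^-1 * t] to [t]. AM-GM splits it between the two
    ends, and translating the share of the first end by [x] collects both shares at [t]. *)
Lemma kesten_letter l (p : 'I_n -> l2 R F2) :
  (forall t, \sum_i Normc.normc (p i t) ^+ 2 <= H t) ->
  complex.Re (\sum_i l2dot (lreg R (gen l) (q i)) (p i)) <=
  rsum (fun t => (weight l t + weight (linv l) t) * H t).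
Proof.
move=> pH; pose x := gen l.
pose v t := weight (linv l) (x^-1 * t)%g * H (x^-1 * t)%g.
have bx := bij_mulgl (x^-1)%g.
have vs : rsummable v.
  exact: (rsummable_reindex bx (weight_summable (linv l))).
have -> : rsum (fun t => (weight l t + weight (linv l) t) * H t) =
    rsum (fun t => v t + weight l t * H t).
  rewrite rsumD// (rsum_reindex bx (fun t => weight (linv l) t * H t)) -rsumD//.
  by congr rsum; apply/funext => t; ring.
rewrite Re_sum -[leLHS](@rsum_sum R F2 _ _ _
  (fun i t => complex.Re (lreg R x (q i) t * conjc (p i t)))); last first.
  by move=> i; have [] := l2dot_csummable (lreg R x (q i)) (p i).
apply: le_rsum => [||t].
- by apply: rsummable_sum => i; have [] := l2dot_csummable (lreg R x (q i)) (p i).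
- exact: rsummableD.
(* Exactly one end of the edge is the child, so the weight at [x^-1 * t] is the one that [t] does
   not get. *)
have -> : v t = (if starts l t then k / 6 else k / 2) * H (x^-1 * t)%g.
  rewrite /v /weight; congr (_ * _).
  have -> : starts l t = ~~ starts (linv l) (x^-1 * t)%g.
    by rewrite -starts_gen -/x mulVKg.
  by rewrite if_neg.
apply: le_trans (lerD (lexx _) (ler_wpM2l (weight_ge0 l t) (pH t))).
rewrite /H !mulr_sumr -big_split/=; apply: ler_sum => i _.
exact: weight_am_gm.
Qed.

(** Summed over both generators, each vertex collects the weights of its four edges, at most [k] in
    all, and [H] has total mass [n]. *)
Lemma kesten (pa pb : 'I_n -> l2 R F2) : orthonormal_family q ->
  (forall t, \sum_i Normc.normc (pa i t) ^+ 2 <= H t) ->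
  (forall t, \sum_i Normc.normc (pb i t) ^+ 2 <= H t) ->
  complex.Re (\sum_i l2dot (lreg R gen_a (q i)) (pa i)) +
  complex.Re (\sum_i l2dot (lreg R gen_b (q i)) (pb i)) <= k * n%:R.
Proof.
move=> oq paH pbH.
have Hn : rsum H = n%:R.
  rewrite /H rsum_sum; last by move=> i; exact: l2_summable.
  under eq_bigr => i _ do rewrite -l2norm_rsum l2norm_dot oq eqxx.
  by rewrite sumr_const card_ord.
have -> : gen_a = gen (false, false) by apply: val_inj.
have -> : gen_b = gen (true, false) by apply: val_inj.
apply: (le_trans (lerD (@kesten_letter (false, false) _ paH)
                       (@kesten_letter (true, false) _ pbH))).
have ws l : rsummable (fun t => (weight l t + weight (linv l) t) * H t).
  under [X in rsummable X]funext => t do rewrite mulrDl.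
  exact: rsummableD.
rewrite -rsumD// -Hn -rsumZ//; apply: le_rsum; [exact: rsummableD|exact: rsummableZ|].
by move=> t; rewrite -mulrDl ler_wpM2r// sum_weight.
Qed.

End Family.
End Kesten.

Section LowerBound.
Variable R : realType.

(** For [f] in the range of [P] the commutator gives [U f - P (U f)], so this is Pythagoras for
    [U f]. *)
Lemma l2norm_compression (P U : l2op R F2) (f : l2 R F2) : is_projection P ->
  (forall g, l2norm (U g) = l2norm g) -> P f = f ->
  l2norm f ^+ 2 <= l2norm (P (U f)) ^+ 2 + (opnorm (comm U P) * l2norm f) ^+ 2.
Proof.
move=> [PP Padj] Uf Pf.
have c_le := l2norm_op_le (comm U P) f.
have -> : l2norm f ^+ 2 = l2norm (P (U f)) ^+ 2 + l2norm (comm U P f) ^+ 2.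
  rewrite -(Uf f) /= Pf.
  set g := U f; rewrite !l2norm_dot.
  have e1 : l2dot g (P g) = l2dot (P g) (P g) by rewrite -{1}PP -Padj.
  have e2 : l2dot (P g) g = l2dot (P g) (P g) by rewrite Padj e1.
  rewrite !(l2dotDl, l2dotDr, l2dotNl, l2dotNr) e1 e2.
  by case: (l2dot _ _) (l2dot _ _) => [a b] [c d] /=; ring.
have m0 := mulr_ge0 (opnorm_ge0 (comm U P)) (l2norm_ge0 f).
by rewrite lerD2l lerXn2r ?nnegrE// l2norm_ge0.
Qed.

Lemma commutator_lower_bound (P : l2op R F2) :
  is_projection P -> finite_rank P -> (exists f, P f != 0) ->
  1 / 2 <= Num.max (opnorm (comm (lreg R gen_a) P)) (opnorm (comm (lreg R gen_b) P)).
Proof.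
move=> Pp [n rP] [f Pf]; rewrite leNgt; apply/negP.
set m := Num.max _ _ => m_lt.
have m0 : 0 <= m by rewrite le_max opnorm_ge0.
pose s := Num.sqrt (1 - m ^+ 2).
have ms : 3 / 4 < 1 - m ^+ 2 by nra.
have s2 : s ^+ 2 = 1 - m ^+ 2 by rewrite sqr_sqrtr//; lra.
have s0 : 0 < s by rewrite sqrtr_gt0; lra.
have [r [q [oq PE]]] := projection_orthonormal Pp rP.
(* Since [P] is nonzero its range has positive dimension; [r] is cancelled from the trace inequality
   below. *)
have r0 : 0 < r%:R :> R.
  rewrite ltr0n lt0n; apply/eqP => r0; move: q oq PE; rewrite r0 => q oq PE.
  by move: Pf; rewrite PE big_ord0 eqxx.
have bound x : opnorm (comm (lreg R x) P) <= m ->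
    forall g, P g = g -> s * l2norm g <= l2norm (P (lreg R x g)).
  move=> xm g Pg; have sg0 := mulr_ge0 (ltW s0) (l2norm_ge0 g).
  rewrite -ler_sqr ?nnegrE ?l2norm_ge0//.
  have := l2norm_compression Pp (@l2norm_lreg R F2 x) Pg.
  rewrite !exprMn s2 => h.
  have : opnorm (comm (lreg R x) P) ^+ 2 * l2norm g ^+ 2 <= m ^+ 2 * l2norm g ^+ 2.
    by rewrite ler_wpM2r ?sqr_ge0// lerXn2r ?nnegrE ?opnorm_ge0.
  by move: h; lra.
have ba := bound gen_a _; rewrite le_max lexx in ba.
have bb := bound gen_b _; rewrite le_max lexx orbT in bb.
have [pa [tra pa_le]] := dual_contraction s0 oq PE (ba isT).
have [pb [trb pb_le]] := dual_contraction s0 oq PE (bb isT).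
(* The traces add up to [2 s r], whence [s ^ 2 <= 3 / 4], against [ms]. *)
have := kesten oq pa_le pb_le.
rewrite tra trb /= -mulrDl ler_pM2r// => s_le.
have : (s + s) ^+ 2 <= 3.
  rewrite -[leRHS](@sqr_sqrtr R 3)// lerXn2r ?nnegrE ?sqrtr_ge0//; lra.
by nra.
Qed.

End LowerBound.

(** * Projections with small commutators *)

Section OrthogonalProjection.
Variables (R : realType) (T : choiceType) (n : nat) (q : 'I_n -> l2 R T).
Implicit Types f g : l2 R T.

Definition orth_proj_fun f : l2 R T := \sum_i l2dot f (q i) *: q i.

Lemma orth_proj_linear : linear orth_proj_fun.
Proof.
move=> c f g; rewrite /orth_proj_fun scaler_sumr -big_split/=.
by apply: eq_bigr => i _; rewrite l2dotDl l2dotZl scalerDl scalerA.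
Qed.

HB.instance Definition _ :=
  GRing.isLinear.Build R[i] (l2 R T) (l2 R T) _ orth_proj_fun orth_proj_linear.

Hypothesis oq : orthonormal_family q.

Lemma orth_proj_sum (c : 'I_n -> R[i]) :
  orth_proj_fun (\sum_i c i *: q i) = \sum_i c i *: q i.
Proof. by apply: eq_bigr => i _; rewrite l2dot_sum_orthonormal. Qed.

Lemma orth_proj_adj f g : l2dot (orth_proj_fun f) g = l2dot f (orth_proj_fun g).
Proof.
rewrite l2dot_suml l2dot_sumr; apply: eq_bigr => i _.
by rewrite l2dotZl l2dotZr -l2dotC mulrC.
Qed.

(** The expansion of [|f - P f|^2 >= 0] gives [|P f|^2 <= |f|^2]. *)
Lemma orth_proj_bounded : l2_bounded orth_proj_fun.
Proof.
exists 1 => f; rewrite mul1r -ler_sqr ?nnegrE ?l2norm_ge0// !l2norm_dot.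
have e : l2dot (orth_proj_fun f) (orth_proj_fun f) = l2dot f (orth_proj_fun f).
  by rewrite orth_proj_adj orth_proj_sum.
have e' : l2dot (orth_proj_fun f) f = l2dot f (orth_proj_fun f) by rewrite orth_proj_adj.
have := sqr_ge0 (l2norm (f - orth_proj_fun f)); rewrite l2norm_dot.
rewrite !(l2dotDl, l2dotDr, l2dotNl, l2dotNr) e e'.
by case: (l2dot _ _) (l2dot _ _) => [a b] [c d] /=; lra.
Qed.

Definition orth_proj : l2op R T := MkL2op orth_proj_bounded.

Lemma orth_proj_is_projection : is_projection orth_proj.
Proof. by split; [move=> f; exact: orth_proj_sum|exact: orth_proj_adj]. Qed.

Lemma orth_proj_has_rank : has_rank orth_proj n.
Proof.
exists q; split=> [c c0 i|].
  by rewrite -(l2dot_sum_orthonormal c i oq) c0 l2dot0l.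
apply/seteqP; split=> _ [f _ <-]; first by exists (fun i => l2dot f (q i)).
by exists (\sum_i f i *: q i) => //; exact: orth_proj_sum.
Qed.

(* With [u i = U (q i)], the vectors [u i] and [q i] span orthogonal planes, one
   for each [i]; the bound comes from comparing [U f] with its projection [w]
   (up to the factor [1 - c ^+ 2]) onto their sum. *)
Lemma opnorm_comm_orth_proj (U : l2op R T) (c : R) :
  (forall f g, l2dot (U f) (U g) = l2dot f g) -> c ^+ 2 < 1 ->
  (forall i j, l2dot (U (q i)) (q j) = c%:C%C * (i == j)%:R) ->
  opnorm (comm U orth_proj) <= Num.sqrt (1 - c ^+ 2).
Proof.
move=> UU c1 Uq; apply: opnorm_le => [|f]; first exact: sqrtr_ge0.
pose u i := U (q i); pose g := U f; pose C := c%:C%C.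
have conjC : conjc C = C by rewrite conjc_real.
pose S (a b : 'I_n -> R[i]) := \sum_i (a i *: u i + b i *: q i).
have dotS h a b : l2dot h (S a b) =
    \sum_i (conjc (a i) * l2dot h (u i) + conjc (b i) * l2dot h (q i)).
  by rewrite l2dot_sumr; apply: eq_bigr => i _; rewrite l2dotDr !l2dotZr.
have Su a b i : l2dot (S a b) (u i) = a i + C * b i.
  rewrite l2dot_suml (bigD1 i)//= big1 ?addr0 => [|j /negPf ji].
    rewrite l2dotDl !l2dotZl UU oq eqxx mulr1 l2dotC Uq eqxx mulr1 conjC.
    by rewrite mulrC [X in _ + X]mulrC.
  by rewrite l2dotDl !l2dotZl UU oq ji l2dotC Uq eq_sym ji !mulr0 conjc0 mulr0 addr0.
have Sq a b i : l2dot (S a b) (q i) = C * a i + b i.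
  rewrite l2dot_suml (bigD1 i)//= big1 ?addr0 => [|j /negPf ji].
    by rewrite l2dotDl !l2dotZl oq Uq eqxx !mulr1 mulrC.
  by rewrite l2dotDl !l2dotZl oq Uq ji !mulr0 addr0.
pose al i := l2dot g (u i); pose be i := l2dot g (q i).
(* These coefficients solve the Gram system of [u i] and [q i], with rows [1, c] and [c, 1], after
   multiplication by its determinant [s2]. *)
pose w := S (fun i => al i - C * be i) (fun i => be i - C * al i).
pose s2 : R := 1 - c ^+ 2.
have s20 : 0 < s2 by rewrite subr_gt0.
have s2C : s2%:C%C = 1 - C * C by rewrite rmorphB rmorph1 rmorphXn.
have -> : comm U orth_proj f = S al (fun i => - be i).
  rewrite /S big_split/= /orth_proj_fun linear_sum -sumrN; congr (_ + _).
    by apply: eq_bigr => i _; rewrite linearZ /al /g UU.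
  by apply: eq_bigr => i _; rewrite scaleNr.
set t := S al _.
have tw : l2dot t t = l2dot g w.
  rewrite !dotS; apply: eq_bigr => i _.
  rewrite Su Sq -/(al i) -/(be i) !conjcD !conjcN !conjcM conjC.
  by ring.
have ww : l2dot w w = s2%:C%C * l2dot g w.
  rewrite !dotS mulr_sumr; apply: eq_bigr => i _.
  by rewrite Su Sq -/(al i) -/(be i) s2C; ring.
have wg : l2dot w g = l2dot g w by rewrite l2dotC -tw l2dotE conjc_real.
(* By [tw] and [ww] this square equals [s2 ^ 2 * |g|^2 - s2 * |t|^2]. *)
have := sqr_ge0 (l2norm (s2%:C%C *: g - w)); rewrite l2norm_dot.
rewrite !(l2dotDl, l2dotDr, l2dotNl, l2dotNr, l2dotZl, l2dotZr) conjc_real.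
rewrite ww wg -tw !l2dotE -!rmorphM -!rmorphN -!rmorphD/=.
have -> : l2norm g ^+ 2 = l2norm f ^+ 2 by rewrite !l2norm_dot UU.
move=> h; have rg := mulr_ge0 (sqrtr_ge0 s2) (l2norm_ge0 f).
rewrite -ler_sqr ?nnegrE ?l2norm_ge0// exprMn [X in _ <= X * _]sqr_sqrtr ?(ltW s20)//.
rewrite -(ler_pM2l s20) -/s2; move: h; clear.
by move: s2 (l2norm t) (l2norm f) => x y z; lra.
Qed.

End OrthogonalProjection.

(** * Radial functions on the free group *)

Section Spheres.
Variable R : realType.

Lemma genV l : gen (linv l) = (gen l)^-1%g.
Proof. exact: val_inj. Qed.

Lemma size_gen l (t : F2) : ~~ starts (linv l) t -> size (gen l * t)%g = (size t).+1.
Proof.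
rewrite /starts; case: t => [[|h r]] rt //=; rewrite (inj_eq Some_inj).
by move=> /negPf ->.
Qed.

Lemma starts_eq l m (t : F2) : starts l t -> starts m t = (m == l).
Proof. by rewrite /starts => /eqP ->; rewrite (inj_eq Some_inj) eq_sym. Qed.

Lemma size_starts (t : F2) : (0 < size t)%N -> exists l, starts l t.
Proof. by case: t => [[|h r]] rt //= _; exists h; rewrite /starts /= eqxx. Qed.

Lemma sum_starts (P : pred letter) l (t : F2) : starts l t ->
  \sum_(m | P m) (starts m t)%:R = (P l)%:R :> R[i].
Proof.
move=> tl; rewrite big_mkcond (bigD1 l)//= tl big1 ?addr0; first by case: (P l).
by move=> m /negPf ml; rewrite (starts_eq _ tl) ml; case: (P m).
Qed.

(** The indicator of the reduced words of length [k + 1] with first letter [l], built by prepending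
    letters so that inner products follow by induction. *)
Fixpoint cone k : letter -> l2 R F2 :=
  if k is j.+1 then fun l => lreg R (gen l) (\sum_(m | m != linv l) cone j m)
  else fun l => delta R (gen l).

Lemma coneE k l t : cone k l t = ((size t == k.+1) && starts l t)%:R.
Proof.
elim: k l t => [|k IH] l t /=.
  congr (nat_of_bool _)%:R; case: t => [[|h [|h' r]] rt]; rewrite -val_eqE //=.
    by rewrite /starts /= (inj_eq Some_inj) eqseq_cons andbT.
  by rewrite eqseq_cons andbF.
set u := (_^-1 * t)%g; have tE : t = (gen l * u)%g by rewrite mulVKg.
rewrite big_mkcond l2_sumE.
transitivity (\sum_(m | m != linv l) ((size u == k.+1) && starts m u)%:R : R[i]).
  by rewrite [RHS]big_mkcond; apply: eq_bigr => m _; case: ifP => // _; rewrite IH.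
have stE : starts l t = ~~ starts (linv l) u by rewrite tE starts_gen.
have szE : starts l t -> (size t == k.+2) = (size u == k.+1).
  by rewrite stE => /size_gen; rewrite tE => ->.
transitivity (((size u == k.+1) && starts l t)%:R : R[i]); last first.
  by case: (boolP (starts l t)) => [/szE ->//|]; rewrite !andbF.
rewrite stE; case: (boolP (size u == k.+1)) => /= su; last by rewrite big1.
have [m um] : exists l, starts l u by apply: size_starts; rewrite (eqP su).
by rewrite (sum_starts _ um) (starts_eq _ um) eq_sym.
Qed.

(** Distinct cones have disjoint supports, and each further level multiplies the number of words by
    three. *)
Lemma l2dot_cone k l j m :
  l2dot (cone k l) (cone j m) = ((k == j) && (l == m))%:R * 3%:R ^+ k.
Proof.
have disj k' l' j' m' : (k' != j') || (l' != m') -> l2dot (cone k' l') (cone j' m') = 0.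
  move=> h; apply: l2dot_disjoint => t; rewrite !coneE.
  have [tl|tl] := boolP (starts l' t); last by left; rewrite andbF.
  have [st|st] := eqVneq (size t) k'.+1; last by left.
  right; rewrite st eqSS (starts_eq m' tl).
  by rewrite [m' == l']eq_sym; case/orP: h => /negPf ->; rewrite ?andbF.
have [->|kj] /= := eqVneq k j; last by rewrite disj ?kj// mul0r.
have [->|lm] := eqVneq l m; last by rewrite disj ?lm ?orbT// mul0r.
rewrite mul1r; elim: j m {k l} => [|j IH] m.
  by rewrite l2dotE l2norm_delta expr1n.
rewrite l2dot_lreg l2dot_suml exprSr.
transitivity (\sum_(l | l != linv m) (3%:R ^+ j : R[i])).
  apply: eq_bigr => l lm; rewrite l2dot_sumr (bigD1 l)//= IH big1 ?addr0//.
  move=> i /andP[_ il].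
  by rewrite disj// eq_sym il orbT.
rewrite sumr_const mulr_natr; congr (_ *+ _).
by rewrite -[LHS]/#|predC1 (linv m)| cardC1 card_prod card_bool.
Qed.

(** The indicator of the sphere of radius [k + 1]; the identity of the group lies in no shell. *)
Definition shell k := \sum_l cone k l.

Lemma l2dot_cone_shell k l j : l2dot (cone k l) (shell j) = (k == j)%:R * 3%:R ^+ k.
Proof.
rewrite l2dot_sumr (bigD1 l)//= l2dot_cone eqxx andbT big1 ?addr0// => m ml.
by rewrite l2dot_cone [l == m]eq_sym (negPf ml) andbF mul0r.
Qed.

Lemma l2dot_shell k j : l2dot (shell k) (shell j) = (k == j)%:R * (4%:R * 3%:R ^+ k).
Proof.
rewrite l2dot_suml; under eq_bigr => l _ do rewrite l2dot_cone_shell.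
by rewrite sumr_const card_prod card_bool -mulr_natl; ring.
Qed.

(** Words not starting with [linv l] get longer and form a cone of the next sphere; the others get
    shorter. *)
Lemma lreg_shell l k : lreg R (gen l) (shell k) =
  cone k.+1 l + lreg R (gen l) (cone k (linv l)).
Proof. by rewrite /shell (bigD1 (linv l))//= linearD addrC. Qed.

Lemma l2dot_lreg_shell l k j : l2dot (lreg R (gen l) (shell k)) (shell j) =
  (k.+1 == j)%:R * 3%:R ^+ j + (k == j.+1)%:R * 3%:R ^+ k.
Proof.
rewrite lreg_shell l2dotDl l2dot_cone_shell; congr (_ + _).
  by case: eqP => [->|] //; rewrite !mul0r.
(* The shortened words form the identity alone if [k = 0], and otherwise the three cones of the
   previous sphere whose first letter is not [l]. *)
case: k => [|k].
  have -> : lreg R (gen l) (cone 0 (linv l)) = delta R 1%g.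
    by rewrite -[cone 0 _]/(delta R (gen (linv l))) lreg_delta genV mulgV.
  rewrite mul0r l2dot_disjoint// => t.
  have [->|t1] := eqVneq t 1%g; last by left; rewrite /= /delta_fun (negPf t1).
  right; rewrite l2_sumE big1// => m _; by rewrite coneE.
rewrite -[cone k.+1 _]/(lreg R (gen (linv l)) (\sum_(m | m != linv (linv l)) cone k m)).
rewrite linvK; set h := \sum_(m | _) _.
have -> : lreg R (gen l) (lreg R (gen (linv l)) h) = h.
  by apply: val_inj; apply/funext => t; rewrite /= genV invgK mulVKg.
rewrite l2dot_suml; under eq_bigr => m _ do rewrite l2dot_cone_shell.
rewrite sumr_const -[X in _ *+ X]/#|predC1 l| cardC1 card_prod card_bool.
by rewrite eqSS exprS -[_ *+ _.-1]mulr_natl mulrCA.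
Qed.

Let k : R := Num.sqrt 3.
Let kk : k * k = 3. Proof. by rewrite -expr2 sqr_sqrtr. Qed.
(** This is the inverse of [sqrt 3]. *)
Let r : R[i] := (k / 3)%:C%C.
Let rr : r * r * 3%:R = 1.
Proof.
rewrite /r -(rmorph_nat (real_complex R)) -!rmorphM -[RHS](rmorph1 (real_complex R)).
congr (_%:C)%C.
have -> : k / 3 * (k / 3) * 3%:R = k * k / 3 by field.
by rewrite kk divff.
Qed.

(** The function [3 ^ (- (|t| - 1) / 2)] on the words with [1 <= |t| <= N]; by this choice every
    sphere carries the same mass 4. *)
Definition radial N := \sum_(i < N) r ^+ i *: shell i.

Let rX i : r ^+ i * (r ^+ i * 3%:R ^+ i) = 1.
Proof. by rewrite mulrA -!exprMn rr expr1n. Qed.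

Let conj_r i : conjc (r ^+ i) = r ^+ i.
Proof. by rewrite /r -rmorphXn; exact: conjc_real. Qed.

Lemma l2dot_radial N : l2dot (radial N) (radial N) = (4 * N)%:R.
Proof.
rewrite l2dot_suml; under eq_bigr => i _.
  rewrite l2dot_sumr (bigD1 i)//= big1 ?addr0; last first.
    move=> j; rewrite eq_sym -val_eqE => /negPf /= ji.
    by rewrite l2dotZl l2dotZr l2dot_shell ji mul0r !mulr0.
  rewrite l2dotZl l2dotZr conj_r l2dot_shell eqxx mul1r.
  rewrite [X in r ^+ i * X](_ : _ = 4%:R * (r ^+ i * 3%:R ^+ i)); last by ring.
  rewrite mulrCA rX mulr1; over.
by rewrite sumr_const card_ord natrM mulr_natr.
Qed.

(** The index [j = 0] has no predecessor; each of the [M] others has exactly one. *)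
Lemma sum_succ M :
  \sum_(i < M.+1) \sum_(j < M.+1) (i.+1 == j :> nat)%:R = M%:R :> R[i].
Proof.
rewrite exchange_big big_ord_recl/= big1 ?add0r; last by [].
transitivity (\sum_(j < M) (1 : R[i])); last by rewrite sumr_const card_ord.
apply: eq_bigr => j _.
rewrite (bigD1 (widen_ord (leqnSn M) j))//= eqxx big1 ?addr0// => i ij.
by rewrite /bump eqSS; case: eqP => // e; case/eqP: ij; exact: val_inj.
Qed.

(** Only consecutive spheres pair. Each of the [M] neighbouring pairs contributes [sqrt 3] twice,
    once in each order. *)
Lemma l2dot_lreg_radial l M :
  l2dot (lreg R (gen l) (radial M.+1)) (radial M.+1) = k%:C%C * (2 * M)%:R.
Proof.
have k3 : r * 3%:R = k%:C%C.
  rewrite /r -(rmorph_nat (real_complex R)) -!rmorphM; congr (_%:C)%C; by field.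
rewrite {1}/radial linear_sum l2dot_suml.
transitivity (\sum_(i < M.+1) \sum_(j < M.+1)
    k%:C%C * ((i.+1 == j :> nat)%:R + (j.+1 == i :> nat)%:R)).
  apply: eq_bigr => i _; rewrite l2dot_sumr; apply: eq_bigr => j _.
  rewrite linearZ l2dotZl l2dotZr conj_r l2dot_lreg_shell mulrDr [RHS]mulrDr mulrDr.
  have e m : r ^+ m * (r ^+ m.+1 * 3%:R ^+ m.+1) = k%:C%C.
    have -> : r ^+ m * (r ^+ m.+1 * 3%:R ^+ m.+1) =
        r * 3%:R * (r ^+ m * (r ^+ m * 3%:R ^+ m)).
      by rewrite !exprS; move: (r ^+ m) (3%:R ^+ m) => x y; ring.
    by rewrite rX mulr1.
  congr (_ + _).
    case: eqVneq => [<-|_]; last by rewrite mul0r !mulr0.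
    by rewrite mul1r mulr1 e.
  case: eqVneq => [->|_]; last by rewrite mul0r !mulr0.
  by rewrite mul1r mulr1 mulrCA e.
under eq_bigr => i _ do rewrite -mulr_sumr big_split/=.
rewrite -mulr_sumr big_split/= sum_succ exchange_big/= sum_succ.
by rewrite -natrD addnn mul2n.
Qed.

Lemma radial_support N (t : F2) : (N < size t)%N -> radial N t = 0.
Proof.
move=> Nt; rewrite l2_sumE big1// => i _.
transitivity (r ^+ i * shell i t) => //; rewrite l2_sumE big1 ?mulr0// => l _.
by rewrite coneE (gtn_eqF (leq_ltn_trans (ltn_ord i) Nt)).
Qed.

End Spheres.

(** * Word length and separated elements *)

Section WordLength.
Implicit Types t u : F2.

Lemma size_consr l w : (size (consr l w) <= (size w).+1)%N.
Proof. by case: w => [|h w] //=; case: ifP => //= _; rewrite ltnW. Qed.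

Lemma size_mul t u : (size (t * u)%g <= size t + size u)%N.
Proof.
case: t => [w rw]; rewrite /=; elim: w {rw} => [|l w IH] //=.
by rewrite (leq_trans (size_consr _ _)).
Qed.

Lemma size_inv t : size (t^-1)%g = size t.
Proof. by rewrite /= size_rev size_map. Qed.

Lemma size_gen_a_exp n : size (gen_a ^+ n)%g = n.
Proof.
suff -> : F2word (gen_a ^+ n)%g = nseq n (false, false) by rewrite size_nseq.
by elim: n => [|n IH] //; rewrite expgS /= IH; case: n {IH}.
Qed.

(** Powers of [gen_a] with exponents spaced by [K + 1] have long quotients. *)
Lemma separated_words K : exists g : nat -> F2,
  forall i j, i != j -> (K < size ((g i)^-1 * g j)%g)%N.
Proof.
exists (fun i => gen_a ^+ (K.+1 * i))%g.
suff H i j : (i < j)%N -> (K < size ((gen_a ^+ (K.+1 * i))^-1 * gen_a ^+ (K.+1 * j))%g)%N.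
  move=> i j; rewrite neq_ltn => /orP[/H//|/H].
  by rewrite -size_inv invgM invgK.
move=> ij; rewrite -(subnKC (ltnW ij)) mulnDr (expgnDr _ (K.+1 * i)) mulKg size_gen_a_exp.
by rewrite (leq_trans _ (leq_pmulr _ _))// subn_gt0.
Qed.

End WordLength.

(** * Orthogonal right translates and the upper bound *)

Section Translates.
Variable R : realType.

Lemma rreg_subproof (g : F2) (f : l2 R F2) : (fun t => f (t * g)%g) \in @l2_pred R F2.
Proof.
apply/l2_predP; rewrite /sqsum.
rewrite -(reindex_esum _ _ _ (fun t => (Normc.normc (f t) ^+ 2)%:E) (bij_mulgr g)).
exact/l2_predP/l2_funP.
Qed.

(** Right translations commute with [lreg], so every translate of [f] has the same inner product
    with its image under [lreg x] as [f] itself. *)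
Definition rreg (g : F2) (f : l2 R F2) : l2 R F2 :=
  MkL2 (fun t => f (t * g)%g) (rreg_subproof g f).

Lemma orthonormal_translates (f : l2 R F2) (c : R) N n : l2dot f f = 1 ->
  (forall t : F2, (N < size t)%N -> f t = 0) ->
  (forall x, x = gen_a \/ x = gen_b -> l2dot (lreg R x f) f = c%:C%C) ->
  exists q : 'I_n -> l2 R F2, orthonormal_family q /\
    forall x, x = gen_a \/ x = gen_b ->
      forall i j, l2dot (lreg R x (q i)) (q j) = c%:C%C * (i == j)%:R.
Proof.
(* If both supports met at [t], the quotient [(g i)^-1 * g j] would be a product of words of lengths
   at most [N], 1 and [N]. *)
move=> ff fN fc; have [g gP] := separated_words (N.+1 + N).
have disj (x : F2) (i j : nat) : (size x <= 1)%N -> i != j ->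
    l2dot (lreg R x (rreg (g i) f)) (rreg (g j) f) = 0.
  move=> x1 ij; apply: l2dot_disjoint => t /=.
  have [s1|/fN] := leqP (size (x^-1 * t * g i)%g) N; last by left.
  have [s2|/fN] := leqP (size (t * g j)%g) N; last by right.
  have := gP i j ij; rewrite ltnNge => /negP[].
  have -> : ((g i)^-1 * g j = ((x^-1 * t * g i)^-1 * x^-1) * (t * g j))%g.
    by rewrite !invgM invgK !mulgA mulgK mulgVK.
  apply: leq_trans (size_mul _ _) (leq_add _ s2).
  apply: leq_trans (size_mul _ _) _.
  by rewrite !size_inv -addn1 leq_add.
exists (fun i => rreg (g i) f); split=> [i j|x xab i j].
  have [<-|ij] := eqVneq i j; first by rewrite -ff;
    exact: (l2dot_reindex (bij_mulgr (g i))).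
  rewrite -val_eqE in ij.
  (* Orthogonality of the translates themselves is the case [x = 1] of [disj]. *)
  have e : lreg R 1%g (rreg (g i) f) = rreg (g i) f.
    apply: val_inj; apply/funext => t.
    by transitivity (f (1^-1 * t * g i)%g) => //; rewrite invg1 mul1g.
  by rewrite -[X in l2dot X _]e disj.
have [<-|ij] := eqVneq i j.
  rewrite mulr1 -(fc x xab); apply: (l2dot_reindex (bij_mulgr (g i))) => t //=.
  by rewrite mulgA.
rewrite -val_eqE in ij.
by rewrite mulr0 disj//; case: xab => ->.
Qed.

Lemma upper_bound (eps : R) (n : nat) : 0 < eps ->
  exists P : l2op R F2,
    [/\ is_projection P, has_rank P n,
        opnorm (comm (lreg R gen_a) P) < 1 / 2 + eps &
        opnorm (comm (lreg R gen_b) P) < 1 / 2 + eps].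
Proof.
move=> e0; pose M := Num.bound (3 / 2 / eps).
have M_gt : 3 / 2 / eps < M%:R by apply: archi_boundP; rewrite !divr_ge0// ltW.
have N0 : 0 < M.+1%:R :> R by rewrite ltr0n.
have k2 : Num.sqrt 3 ^+ 2 = 3 :> R by rewrite sqr_sqrtr.
(* The normalising factor, as [radial R M.+1] has squared norm [4 * M.+1]. *)
pose a : R := (2 * Num.sqrt M.+1%:R)^-1.
have a2 : a ^+ 2 = (4 * M.+1%:R)^-1.
  by rewrite exprVn exprMn sqr_sqrtr ?ler0n//; congr (_ * _)^-1; ring.
pose f := a%:C%C *: radial R M.+1.
(* The overlap [sqrt 3 * 2 M] of the radial function with its translate, divided by [4 * M.+1]. *)
pose c : R := Num.sqrt 3 / 2 * (M%:R / M.+1%:R).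
have ff : l2dot f f = 1.
  rewrite l2dotZl l2dotZr l2dot_radial conjc_real -(rmorph_nat (real_complex R)).
  rewrite -!rmorphM -[RHS](rmorph1 (real_complex R)); congr (_%:C)%C.
  by rewrite mulrA -expr2 a2 natrM mulVf// mulf_neq0// gt_eqF.
have fN t : (M.+1 < size (t : F2))%N -> f t = 0.
  by move=> Mt; rewrite -[f t]/(a%:C%C * radial R M.+1 t) radial_support// mulr0.
have fc x : x = gen_a \/ x = gen_b -> l2dot (lreg R x f) f = c%:C%C.
  have E l : l2dot (lreg R (gen l) f) f = c%:C%C.
    rewrite linearZ l2dotZl l2dotZr l2dot_lreg_radial conjc_real.
    rewrite -(rmorph_nat (real_complex R)) -!rmorphM; congr (_%:C)%C.
    rewrite mulrA -expr2 a2 natrM /c; field.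
    by rewrite gt_eqF.
  have -> : gen_a = gen (false, false) by apply: val_inj.
  have -> : gen_b = gen (true, false) by apply: val_inj.
  by case=> ->.
have [q [oq qc]] := orthonormal_translates n ff fN fc.
pose d : R := M.+1%:R^-1.
have d0 : 0 < d by rewrite invr_gt0.
have de : 3 / 2 * d < eps.
  move: M_gt; rewrite ltr_pdivrMr// => M_gt.
  rewrite -(ltr_pM2r N0) -[ltLHS]mulrA [d * _]mulVf ?gt_eqF// mulr1 -natr1.
  by move: M_gt; lra.
have c2 : c ^+ 2 = 3 / 4 * (1 - d) ^+ 2.
  have -> : 1 - d = M%:R / M.+1%:R.
    by rewrite /d -natr1; field; rewrite natr1 gt_eqF.
  by rewrite exprMn exprMn k2; move: (M%:R / _) => x; field.
have d1 : d <= 1 by rewrite invf_le1// ler1n.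
have c1 : c ^+ 2 < 1 by rewrite c2; nra.
have bound x : x = gen_a \/ x = gen_b ->
    opnorm (comm (lreg R x) (orth_proj oq)) < 1 / 2 + eps.
  move=> xab; apply: le_lt_trans (opnorm_comm_orth_proj oq _ c1 (qc x xab)) _.
    exact: l2dot_lreg.
  (* With [d = 1 / (M + 1)], [1 - c ^ 2] is at most [1 / 4 + 3 / 2 * d], hence less than
     [1 / 4 + eps], which is below [(1 / 2 + eps) ^ 2]. *)
  rewrite -ltr_sqr ?nnegrE ?sqrtr_ge0 ?addr_ge0 ?(ltW e0)//.
  rewrite sqr_sqrtr ?subr_ge0 ?(ltW c1)//.
  by rewrite c2; nra.
exists (orth_proj oq); split; [exact: orth_proj_is_projection|exact: orth_proj_has_rank|..];
  apply: bound; by [left|right].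
Qed.

End Translates.

(** * The value of the constant *)

Theorem theorem2p5 (R : realType) :
  (forall (eps : R) (n : nat), 0 < eps -> (1 <= n)%N ->
     exists P : l2op R F2,
       [/\ is_projection P, has_rank P n,
           opnorm (comm (lreg R gen_a) P) < 1 / 2 + eps &
           opnorm (comm (lreg R gen_b) P) < 1 / 2 + eps]) /\
  C_ R [fset gen_a; gen_b]%fset = 1 / 2.
Proof.
split=> [eps n eps0 _|]; first exact: upper_bound.
pose nrm (x : F2) (P : l2op R F2) := opnorm (comm (lreg R x) P).
have supE P : sup [set nrm x P | x in [set` [fset gen_a; gen_b]%fset]] =
    Num.max (nrm gen_a P) (nrm gen_b P).
  set A := [set _ | _ in _]; set m := Num.max _ _.
  have Aa : A (nrm gen_a P) by exists gen_a; rewrite //= !inE eqxx.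
  have Ab : A (nrm gen_b P) by exists gen_b; rewrite //= !inE eqxx orbT.
  have Am : ubound A m.
    by move=> _ [x /= + <-]; rewrite !inE => /orP[] /eqP ->;
      rewrite le_max lexx ?orbT.
  have supA : has_sup A by split; [exists (nrm gen_a P)|exists m].
  apply/eqP; rewrite eq_le; apply/andP; split.
    by apply: ge_sup => //; exists (nrm gen_a P).
  by rewrite ge_max !(sup_upper_bound supA).
rewrite /C_; set D := [set P | _]; set E := [set _ | _ in D].
have lbE : lbound E (1 / 2).
  by move=> _ [P [Pp [Pr Pn]] <-]; rewrite supE; exact: commutator_lower_bound.
have ubE (eps : R) : 0 < eps -> exists2 y, E y & y < 1 / 2 + eps.
  (* Rank one suffices here; the basis vector of the range is nonzero, so [P] is nonzero. *)
  move=> eps0; have [P [Pp Pr Pa Pb]] := upper_bound 1 eps0.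
  exists (sup [set nrm x P | x in [set` [fset gen_a; gen_b]%fset]]).
    exists P => //; split=> //; split; first by exists 1.
    have [e [ei rP]] := Pr.
    have [f _ Pf] : range P (e ord0).
      by rewrite rP; exists (fun=> 1) => //; rewrite big_ord1 scale1r.
    exists f; rewrite Pf; apply/eqP => e0.
    have h : \sum_(i < 1) (1 : R[i]) *: e i = 0 by rewrite big_ord1 scale1r.
    by have := ei (fun=> 1) h ord0; move/eqP; rewrite oner_eq0.
  by rewrite supE gt_max Pa.
(* The real infimum needs a nonempty set, which [y] witnesses. *)
have [y Ey _] := ubE 1 ltr01.
apply/eqP; rewrite eq_le; apply/andP; split; last by apply: lb_le_inf => //; exists y.
apply/ler_addgt0Pr => eps eps0; have [z Ez zlt] := ubE _ eps0.
by apply: (le_trans _ (ltW zlt)); apply: ge_inf => //; exists (1 / 2).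
Qed.
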